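(* Let $(M,g)$ be a Riemannian manifold, let $q\in\mathbb{R}$ and let $X$ be a smooth unit vector field on $M$. Then $X$ is a magnetic map with charge $q$ into the unit tangent sphere bundle $UM$ (that is, $\tau_1(X)=q\,\phi(X_*X)$) if and only if $$\mathrm{tr}_{g}R(\nabla_\cdot X,X)\cdot\;=\;q\,\nabla_{X}X\qquad\text{and}\qquad \overline{\Delta}_{g}X=|\nabla X|^2\,X .$$
   Context: Let $\nabla$ be the Levi-Civita connection of $(M,g)$, $R(Y,Z)W=\nabla_Y\nabla_ZW-\nabla_Z\nabla_YW-\nabla_{[Y,Z]}W$, and let $\{e_i\}$ be a local orthonormal frame field of $M$. Put $\mathrm{tr}_gR(\nabla_\cdot X,X)\cdot=\sum_i R(\nabla_{e_i}X,X)e_i$, $|\nabla X|^2=\sum_i g(\nabla_{e_i}X,\nabla_{e_i}X)$, and let $\overline{\Delta}_gX=-\sum_i(\nabla_{e_i}\nabla_{e_i}X-\nabla_{\nabla_{e_i}e_i}X)$ be the rough Laplacian. For $u\in T_pM$ and $Y\in T_pM$, let $Y^{\mathsf v}_u=\frac{d}{dt}|_{t=0}(u+tY)\in T_u(TM)$ be the vertical lift, and let $Y^{\mathsf h}_u\in T_u(TM)$ be the horizontal lift, i.e. the initial velocity of the parallel transport of $u$ along a curve in $M$ with initial velocity $Y$. The Sasaki metric $g_S$ and the almost complex structure $J$ on $TM$ are given by $g_S(Y^{\mathsf h},Z^{\mathsf h})=g_S(Y^{\mathsf v},Z^{\mathsf v})=g(Y,Z)$, $g_S(Y^{\mathsf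 h},Z^{\mathsf v})=0$, $JY^{\mathsf h}=Y^{\mathsf v}$, $JY^{\mathsf v}=-Y^{\mathsf h}$. The unit tangent sphere bundle $UM\subset TM$ carries the induced metric, also denoted $g_S$; its unit normal is $\boldsymbol{U}_u=u^{\mathsf v}_u$. Put $\xi=-J\boldsymbol{U}$, $\eta=g_S(\xi,\cdot)$, and define the endomorphism field $\phi$ of $T(UM)$ by $JV=\phi V+\eta(V)\boldsymbol{U}$. The 2-form $g_S(\phi\cdot,\cdot)=-d\eta$ is the magnetic field on $UM$, with Lorentz force $\phi$. A unit vector field $X$ is regarded as a smooth map $X:(M,g)\to(UM,g_S)$; $\tau_1(X)=\mathrm{tr}_g(\nabla dX)$ is its tension field, and $X_*X$ is the section $p\mapsto dX_p(X_p)$ of $X^*T(UM)$. $X$ is a magnetic map into $UM$ with charge $q$ if $\tau_1(X)=q\,\phi(X_*X)$. *)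

(* Defs.v *)
From mathcomp Require Import all_boot all_order all_algebra.
From mathcomp Require Import all_classical all_reals all_analysis.
From mathcomp Require Import ring.
Import Order.TTheory GRing.Theory Num.Theory.
Import numFieldNormedType.Exports.

Set Implicit Arguments.
Unset Strict Implicit.
Unset Printing Implicit Defensive.

Local Open Scope classical_set_scope.
Local Open Scope ring_scope.

(* Vectors are rows, and the derivative of a map f between coordinate spaces
   in the direction v is 'D_v f. *)

Section Smooth.
Context {R : realType} {V W : normedModType R}.

Definition iterD (vs : seq V) (f : V -> W) : V -> W :=
  foldr (fun v h x => 'D_v h x) f vs.

(* C^infinity on the set U, which is open in all uses. *)
Definition smooth_on (U : set V) (f : V -> W) : Prop :=
  forall (vs : seq V) (x : V), U x -> differentiable (iterD vs f) x.

End Smooth.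

(* In this section G x is the matrix of a metric at the point of coordinates x,
   and vector fields are given by their components in the same coordinates. *)

Section LocalGeometry.
Context {R : realType} {n : nat}.
Local Notation E := 'rV[R]_n.
Implicit Types (G : E -> 'M[R]_n) (x v w : E) (Y Z W X : E -> E).

Definition dx (i : 'I_n) : E := delta_mx 0 i.

Definition dot (A : 'M[R]_n) (v w : E) : R := (v *m A *m w^T) 0 0.

Definition dG G (k i j : 'I_n) x : R := 'D_(dx k) (fun y => G y i j) x.

(* Christoffel symbol with upper index k and lower indices i, j. *)
Definition christoffel G x (k i j : 'I_n) : R :=
  2^-1 * \sum_l invmx (G x) k l * (dG G i j l x + dG G j i l x - dG G l i j x).

Definition Gam G x v w : E :=
  \row_k \sum_i \sum_j christoffel G x k i j * v 0 i * w 0 j.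

(* nabla_Y Z for the Levi-Civita connection; christoffel_torsion_free and
   christoffel_metric below are its two characteristic properties. *)
Definition cov G Y Z : E -> E :=
  fun x => 'D_(Y x) Z x + Gam G x (Y x) (Z x).

Definition bracket Y Z : E -> E := fun x => 'D_(Y x) Z x - 'D_(Z x) Y x.

Definition curv G Y Z W : E -> E :=
  fun x => cov G Y (cov G Z W) x - cov G Z (cov G Y W) x
           - cov G (bracket Y Z) W x.

Definition orthonormal_frame G (D O : set E) (e : 'I_n -> E -> E) : Prop :=
  [/\ open O, O `<=` D, forall i, smooth_on O (e i)
    & forall x, O x -> forall i j, dot (G x) (e i x) (e j x) = (i == j)%:R].

Definition tr_curv G (e : 'I_n -> E -> E) X : E -> E :=
  fun x => \sum_i curv G (cov G (e i) X) X (e i) x.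

Definition rough_laplacian G (e : 'I_n -> E -> E) X : E -> E :=
  fun x => - \sum_i (cov G (e i) (cov G (e i) X) x
                     - cov G (cov G (e i) (e i)) X x).

Definition normsq_cov G (e : 'I_n -> E -> E) X : E -> R :=
  fun x => \sum_i dot (G x) (cov G (e i) X x) (cov G (e i) X x).

Lemma christoffel_torsion_free G x k i j :
  (forall y, (G y)^T = G y) ->
  christoffel G x k i j = christoffel G x k j i.
Proof.
move=> sG; rewrite /christoffel; congr (_ * _); apply: eq_bigr => l _.
have -> : dG G l i j x = dG G l j i x.
  rewrite /dG (_ : (fun y => G y i j) = (fun y => G y j i)) //.
  by apply/funext => y; rewrite -[in LHS]sG mxE.
by rewrite [dG G i j l x + _]addrC.
Qed.

Lemma christoffel_metric G x k i j :
  (forall y, (G y)^T = G y) -> G x \in unitmx ->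
  dG G k i j x = \sum_l (christoffel G x l k i * G x l j
                         + christoffel G x l k j * G x i l).
Proof.
move=> sG uG.
have sym a b y : G y a b = G y b a by rewrite -[in LHS]sG mxE.
have sdG a b c : dG G a b c x = dG G a c b x.
  rewrite /dG (_ : (fun y => G y b c) = (fun y => G y c b)) //.
  by apply/funext => y.
have lower a b c : \sum_l christoffel G x l a b * G x l c =
    2^-1 * (dG G a b c x + dG G b a c x - dG G c a b x).
  pose F m := dG G a b m x + dG G b a m x - dG G m a b x.
  rewrite -/(F c).
  transitivity (2^-1 * \sum_m (G x *m invmx (G x)) c m * F m).
    under [in RHS]eq_bigr => m _ do rewrite mxE mulr_suml.
    rewrite exchange_big /= mulr_sumr; apply: eq_bigr => l _.
    rewrite /christoffel -mulrA; congr (_ * _).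
    rewrite mulr_suml; apply: eq_bigr => m _.
    by rewrite (sym l c) mulrC mulrA.
  congr (_ * _); rewrite mulmxV // (bigD1 c) //= big1 ?addr0 => [|m mc].
    by rewrite !mxE eqxx mul1r.
  by rewrite !mxE eq_sym (negbTE mc) mul0r.
rewrite big_split /= lower.
under eq_bigr => l _ do rewrite (sym i l).
rewrite lower -mulrDr (sdG k j i) (sdG i k j).
set a := dG G k i j x; set b := dG G j k i x; set d := dG G i j k x.
by field.
Qed.

End LocalGeometry.

Section Tension.
Context {R : realType} {n k : nat}.
Variables (G : 'rV[R]_n -> 'M[R]_n) (H : 'rV[R]_k -> 'M[R]_k).
Variable h : 'rV[R]_n -> 'rV[R]_k.

(* (nabla dh)(v, w) for constant v and w; on the target side the connection is
   the pull-back along h of the Levi-Civita connection of H. *)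
Definition second_fundamental_form (x v w : 'rV[R]_n) : 'rV[R]_k :=
  'D_v (fun y => 'D_w h y) x + Gam H (h x) ('D_v h x) ('D_w h x)
  - 'D_(Gam G x v w) h x.

Definition tension (x : 'rV[R]_n) : 'rV[R]_k :=
  \sum_i \sum_j
    invmx (G x) i j *: second_fundamental_form x (dx i) (dx j).

(* Matrix of s^* Q, for Q z a bilinear form on the tangent space at z. *)
Definition pullback {m : nat} (Q : 'rV[R]_m -> 'rV[R]_m -> 'rV[R]_m -> R)
    (s : 'rV[R]_k -> 'rV[R]_m) : 'rV[R]_k -> 'M[R]_k :=
  fun y => \matrix_(a, b) Q (s y) ('D_(dx a) s y) ('D_(dx b) s y).

End Tension.

(* A tangent vector u at the point of coordinates x is encoded by
   z = row_mx x u. *)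

Section Sasaki.
Context {R : realType} {n : nat}.
Variable G : 'rV[R]_n -> 'M[R]_n.
Local Notation E := 'rV[R]_n.
Local Notation TE := 'rV[R]_(n + n).
Implicit Types (z A B V : TE) (Y Z : E).

Definition base z : E := lsubmx z.
Definition fiber z : E := rsubmx z.

Definition vlift z Y : TE := row_mx 0 Y.
Definition hlift z Y : TE := row_mx Y (- Gam G (base z) Y (fiber z)).

(* A = hlift z (hpart A) + vlift z (vpart z A), see hv_decomposition. *)
Definition hpart A : E := lsubmx A.
Definition vpart z A : E := rsubmx A + Gam G (base z) (lsubmx A) (fiber z).

Definition sasaki z A B : R :=
  dot (G (base z)) (hpart A) (hpart B) +
  dot (G (base z)) (vpart z A) (vpart z B).

Definition Jtm z A : TE := vlift z (hpart A) - hlift z (vpart z A).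

(* The unit normal of UM in TM, and the tensors xi, eta and phi. *)
Definition Unormal z : TE := vlift z (fiber z).
Definition xi z : TE := - Jtm z (Unormal z).
Definition eta z V : R := sasaki z (xi z) V.
Definition phi z V : TE := Jtm z V - eta z V *: Unormal z.

Lemma hv_decomposition z A :
  A = hlift z (hpart A) + vlift z (vpart z A).
Proof.
rewrite /hlift /vlift /hpart /vpart add_row_mx addr0.
by rewrite [rsubmx A + _]addrC addrA addNr add0r hsubmxK.
Qed.

Lemma Gam0l x Y : Gam G x 0 Y = 0.
Proof.
apply/rowP => k; rewrite !mxE big1 // => i _; rewrite big1 // => j _.
by rewrite !mxE mulr0 mul0r.
Qed.

Lemma hpart_hlift z Y : hpart (hlift z Y) = Y.
Proof. exact: row_mxKl. Qed.

Lemma hpart_vlift z Y : hpart (vlift z Y) = 0.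
Proof. exact: row_mxKl. Qed.

Lemma vpart_hlift z Y : vpart z (hlift z Y) = 0.
Proof. by rewrite /vpart /hlift row_mxKl row_mxKr addNr. Qed.

Lemma vpart_vlift z Y : vpart z (vlift z Y) = Y.
Proof. by rewrite /vpart /vlift row_mxKl row_mxKr Gam0l addr0. Qed.

Lemma dot0l (A : 'M[R]_n) v : dot A 0 v = 0.
Proof. by rewrite /dot !mul0mx mxE. Qed.

Lemma dot0r (A : 'M[R]_n) v : dot A v 0 = 0.
Proof. by rewrite /dot trmx0 mulmx0 mxE. Qed.

Lemma sasaki_hh z Y Z :
  sasaki z (hlift z Y) (hlift z Z) = dot (G (base z)) Y Z.
Proof. by rewrite /sasaki !hpart_hlift !vpart_hlift dot0l addr0. Qed.

Lemma sasaki_vv z Y Z :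
  sasaki z (vlift z Y) (vlift z Z) = dot (G (base z)) Y Z.
Proof. by rewrite /sasaki !hpart_vlift !vpart_vlift dot0l add0r. Qed.

Lemma sasaki_hv z Y Z : sasaki z (hlift z Y) (vlift z Z) = 0.
Proof.
by rewrite /sasaki hpart_vlift vpart_hlift dot0l dot0r addr0.
Qed.

Lemma Jtm_hlift z Y : Jtm z (hlift z Y) = vlift z Y.
Proof.
rewrite /Jtm hpart_hlift vpart_hlift /hlift Gam0l oppr0.
by rewrite row_mx0 subr0.
Qed.

Lemma Jtm_vlift z Y : Jtm z (vlift z Y) = - hlift z Y.
Proof. by rewrite /Jtm hpart_vlift vpart_vlift /vlift row_mx0 sub0r. Qed.

(* hlift is the initial velocity of a parallel field u along a curve c. *)
Lemma hlift_parallel (c u : R -> E) :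
  derivable c 0 1 -> derivable u 0 1 ->
  'D_1 u 0 + Gam G (c 0) ('D_1 c 0) (u 0) = 0 ->
  'D_1 (fun t => row_mx (c t) (u t)) 0 = hlift (row_mx (c 0) (u 0)) ('D_1 c 0).
Proof.
move=> dc du par.
have M i j : derivable (fun t => row_mx (c t) (u t) i j) 0 1.
  case: (split_ordP j) => k ->.
    under eq_fun do rewrite row_mxEl.
    by move/derivable_mxP : dc => /(_ i k).
  under eq_fun do rewrite row_mxEr.
  by move/derivable_mxP : du => /(_ i k).
rewrite derive_mx; last exact/derivable_mxP.
have -> : hlift (row_mx (c 0) (u 0)) ('D_1 c 0) = row_mx ('D_1 c 0) ('D_1 u 0).
  rewrite /hlift /base /fiber row_mxKl row_mxKr; congr row_mx.
  by apply/eqP; rewrite eq_sym -addr_eq0; apply/eqP.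
apply/matrixP => i j; rewrite mxE; case: (split_ordP j) => k ->.
  rewrite row_mxEl (derive_mx dc) mxE.
  under eq_fun do rewrite row_mxEl.
  by [].
rewrite row_mxEr (derive_mx du) mxE.
under eq_fun do rewrite row_mxEr.
by [].
Qed.

End Sasaki.

(* cfun and cinv are total; only their values on cdom and cimg matter. *)
Record chart (R : realType) (T : Type) (k : nat) := Chart {
  cdom : set T;
  cfun :> T -> 'rV[R]_k;
  cinv : 'rV[R]_k -> T;
  chartK : forall p, cdom p -> cinv (cfun p) = p;
  open_cimg : open (cfun @` cdom) }.

Definition cimg (R : realType) (T : Type) (k : nat) (c : chart R T k) :
  set 'rV[R]_k := c @` cdom c.

Record manifold (R : realType) (n : nat) := Manifold {
  carrier :> topologicalType;
  atlas : set (chart R carrier n);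
  manifold_hausdorff : hausdorff_space carrier;
  manifold_countable : @second_countable carrier;
  atlas_cover : forall p, exists c, atlas c /\ cdom c p;
  atlas_open : forall c, atlas c -> open (cdom c);
  atlas_continuous : forall c, atlas c -> {within cdom c, continuous c};
  atlas_continuousV : forall c, atlas c -> {within cimg c, continuous (cinv c)};
  atlas_compat : forall c d, atlas c -> atlas d ->
    smooth_on (cimg c `&` cinv c @^-1` cdom d) (d \o cinv c) }.

Section Manifolds.
Context {R : realType} {n : nat}.
Variable M : manifold R n.
Local Notation E := 'rV[R]_n.

(* T_pM is identified with R^n through a chart chosen once and for all at p;
   tcoord gives the components of a tangent vector in any other chart c, and
   tvec recovers the vector at cinv c x from its components w in c. *)
Definition chart_at (p : M) : chart R M n := projT1 (cid (atlas_cover p)).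

Definition tcoord (c : chart R M n) (p : M) (v : E) : E :=
  'D_v (c \o cinv (chart_at p)) (chart_at p p).

Definition tvec (c : chart R M n) (x w : E) : E :=
  'D_w (chart_at (cinv c x) \o cinv c) x.

Definition TM : Type := (M * E)%type.

Definition tfun (c : chart R M n) (u : TM) : 'rV[R]_(n + n) :=
  row_mx (c u.1) (tcoord c u.1 u.2).

Definition tinv (c : chart R M n) (z : 'rV[R]_(n + n)) : TM :=
  (cinv c (base z), tvec c (base z) (fiber z)).

Definition tdom (c : chart R M n) : set TM := [set u | cdom c u.1].

Lemma atlas_chart_at p : atlas (chart_at p).
Proof. by rewrite /chart_at; case: cid => c []. Qed.

Lemma cdom_chart_at p : cdom (chart_at p) p.
Proof. by rewrite /chart_at; case: cid => c []. Qed.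

Lemma transitionK (c d : chart R M n) (p : M) (v : E) :
  atlas c -> atlas d -> cdom c p -> cdom d p ->
  'D_('D_v (d \o cinv c) (c p)) (c \o cinv d) (d p) = v.
Proof.
move=> ac ad cp dp.
have dcd : differentiable (d \o cinv c) (c p).
  by apply: (atlas_compat ac ad [::]); split; [exists p | rewrite /= chartK].
have ddc : differentiable (c \o cinv d) ((d \o cinv c) (c p)).
  rewrite /= chartK //; apply: (atlas_compat ad ac [::]).
  by split; [exists p | rewrite /= chartK].
have dpE : d p = (d \o cinv c) (c p) by rewrite /= chartK.
rewrite [in LHS]dpE deriveE // deriveE //.
rewrite -[LHS]/(('d (c \o cinv d) ((d \o cinv c) (c p))
                 \o 'd (d \o cinv c) (c p)) v).
rewrite -diff_comp // -deriveE; last exact: differentiable_comp.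
apply: (etrans _ (derive_id (c p) v)).
apply: (@near_eq_derive R _ _ ((c \o cinv d) \o (d \o cinv c)) id (c p) v).
have oC : open (cimg c) by exact: open_cimg.
have cimgp : cimg c (c p) by exists p.
have cont : {for c p, continuous (cinv c)}.
  have := atlas_continuousV ac.
  by rewrite continuous_open_subspace // => /(_ _ (mem_set cimgp)).
have nd : \forall y \near c p, cdom d (cinv c y).
  apply: cont; apply: open_nbhs_nbhs; split; first exact: atlas_open.
  by rewrite chartK.
have nc : \forall y \near c p, cimg c y by exact: open_nbhs_nbhs.
near=> y => /=.
rewrite chartK; last by near: y.
have [r cr <-] : cimg c y by near: y.
by rewrite chartK.
Unshelve. all: by end_near. Qed.

Lemma tchartK c : atlas c -> forall u, tdom c u -> tinv c (tfun c u) = u.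
Proof.
move=> ac [p v] cp; rewrite /tinv /tfun /base /fiber row_mxKl row_mxKr /=.
rewrite /tvec /tcoord chartK //; congr pair.
exact: (transitionK _ (atlas_chart_at p) ac (cdom_chart_at p) cp).
Qed.

Lemma tchart_img c : atlas c ->
  tfun c @` tdom c = lsubmx @^-1` (cimg c).
Proof.
move=> ac; apply/seteqP; split => [_ [u cu <-]|z /= [p cp pz]].
  by rewrite /= /tfun row_mxKl; exists u.1.
exists (tinv c z); first by rewrite /tdom /= /base -pz chartK.
rewrite /tinv /tfun /= /base /fiber -pz chartK // -[RHS]hsubmxK -pz.
rewrite /tcoord /tvec chartK //; congr row_mx.
exact: (transitionK _ ac (atlas_chart_at p) cp (cdom_chart_at p)).
Qed.

Lemma open_tchart_img c : atlas c -> open (tfun c @` tdom c).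
Proof.
move=> ac; rewrite tchart_img //; apply: open_comp; last exact: open_cimg.
by move=> z _; exact: continuous_lsubmx.
Qed.

Definition tchart (c : chart R M n) (ac : atlas c) : chart R TM (n + n) :=
  Chart (tchartK ac) (open_tchart_img ac).

Definition tm_atlas : set (chart R TM (n + n)) :=
  [set d | exists (c : chart R M n) (ac : atlas c), d = tchart ac].

Definition lift_field (X : M -> E) (p : M) : TM := (p, X p).

Definition vcomp (c : chart R M n) (X : M -> E) : E -> E :=
  fun x => tcoord c (cinv c x) (X (cinv c x)).

Definition smooth_field (X : M -> E) : Prop :=
  forall c, atlas c -> smooth_on (cimg c) (vcomp c X).

(* Matrix, in the chart c, of the bilinear forms with matrices g p on T_pM. *)
Definition mcomp (c : chart R M n) (g : M -> 'M[R]_n) : E -> 'M[R]_n :=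
  fun x => \matrix_(i, j)
    dot (g (cinv c x)) (tvec c x (dx i)) (tvec c x (dx j)).

End Manifolds.

Record riemannian (R : realType) (n : nat) (M : manifold R n) := Riemannian {
  metric :> M -> 'M[R]_n;
  metric_sym : forall p, (metric p)^T = metric p;
  metric_pos : forall p v, v != 0 -> 0 < dot (metric p) v v;
  metric_smooth : forall c, atlas c -> smooth_on (cimg c) (mcomp c metric) }.

(* psi is a diffeomorphism from a relatively open part of S onto an open part
   of R^k, where S is a subset of a space T with smooth atlas A. As usual, a
   map on S is smooth when it is locally the restriction of a smooth map. *)
Definition submanifold_chart (R : realType) (T : Type) (m k : nat)
    (A : set (chart R T m)) (S : set T) (psi : chart R T k) : Prop :=
  [/\ cdom psi `<=` S,
      forall c, A c ->
        open (cimg psi `&` cinv psi @^-1` cdom c) /\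
        smooth_on (cimg psi `&` cinv psi @^-1` cdom c) (c \o cinv psi)
    & forall c u, A c -> cdom c u -> cdom psi u ->
        exists (O : set 'rV[R]_m) (F : 'rV[R]_m -> 'rV[R]_k),
          [/\ open O, O (c u), smooth_on O F
            & forall v, S v -> cdom c v -> O (c v) ->
                cdom psi v /\ psi v = F (c v)]].

Section UnitTangentBundle.
Context {R : realType} {n : nat} {M : manifold R n}.
Variable g : riemannian M.

Definition unit_field (X : M -> 'rV[R]_n) : Prop :=
  forall p, dot (g p) (X p) (X p) = 1.

Definition UM : set (TM M) := [set u | dot (g u.1) u.2 u.2 = 1].

Definition UM_chart (psi : chart R (TM M) (n + n).-1) : Prop :=
  submanifold_chart (@tm_atlas R n M) UM psi.

(* The inclusion of UM in TM, read in the charts psi of UM and tfun c of TM. *)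
Definition UM_incl (c : chart R M n) (psi : chart R (TM M) (n + n).-1) :
  'rV[R]_((n + n).-1) -> 'rV[R]_(n + n) := tfun c \o cinv psi.

Definition UM_metric (c : chart R M n) (psi : chart R (TM M) (n + n).-1) :
  'rV[R]_((n + n).-1) -> 'M[R]_((n + n).-1) :=
  pullback (sasaki (mcomp c g)) (UM_incl c psi).

(* tau_1(X) = q phi(X_* X), as an equality in the tangent space of TM at X p;
   tau_1(X) is computed in the chart psi of UM, then sent there by the
   differential of the inclusion. *)
Definition magnetic_map (q : R) (X : M -> 'rV[R]_n) : Prop :=
  forall (c : chart R M n) (psi : chart R (TM M) (n + n).-1) (p : M),
    atlas c -> UM_chart psi -> cdom c p -> cdom psi (lift_field X p) ->
    let h := psi \o lift_field X \o cinv c in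
    let Xc := tfun c \o lift_field X \o cinv c in
    let tau := tension (mcomp c g) (UM_metric c psi) h (c p) in
    let dX_X := 'D_(vcomp c X (c p)) Xc (c p) in
    'D_tau (UM_incl c psi) (h (c p)) = q *: phi (mcomp c g) (Xc (c p)) dX_X.

End UnitTangentBundle.

(* Main.v *)
(* In a chart of UM the inclusion into TM reads y |-> (b y, u y), and the metric
   of UM is H(v, w) = g(D_v b, D_w b) + g(nabla_v u, nabla_w u), where nabla is
   the Levi-Civita connection pulled back along b. This connection is metric and
   torsion free and has curvature R, so the Koszul formula for H and the pair
   symmetry of R give, for every tangent vector a of UM,
     H(tau_1(X), a) = - g(Delta X, nabla_a u) - g(tr R(nabla X, X), D_a b),
   without the Christoffel symbols of the Sasaki metric. By dimension the pairs
   (D_a b, nabla_a u) are all (al, be) with g(be, X) = 0. Hence tau_1(X) has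
   horizontal part - tr R(nabla X, X), and its vertical part is the projection
   of - Delta X to the orthogonal of X, that is |nabla X|^2 X - Delta X because
   |X| = 1. On the other side phi (X_* X) = - (nabla_X X)^h. Stereographic
   charts of UM and the Gram-Schmidt process make charts and frames available
   at every point. *)

Require Import Defs.
From mathcomp Require Import all_boot all_order all_algebra.
From mathcomp Require Import all_classical all_reals all_analysis.
From mathcomp Require Import ring lra.
Import Order.TTheory GRing.Theory Num.Theory.
Import numFieldNormedType.Exports.

Set Implicit Arguments.
Unset Strict Implicit.
Unset Printing Implicit Defensive.

Local Open Scope classical_set_scope.
Local Open Scope ring_scope.

(** * Smooth maps *)

(** The chart of the unit bundle in [magnetic_map] is arbitrary, so the tension field is never
    available in explicit coordinates. What is used of a chart is that its inclusion [iota] into the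
    tangent bundle is smooth, takes values in unit vectors and has a smooth local left inverse; the
    last point makes [iota] an immersion, and together with the dimension it identifies the tangent
    spaces. The tension is then known only through its pairings, and positivity of [g] recovers both
    of its parts. Frames, fields and charts carry information on open sets only, although the
    functions that encode them are total. Hence an identity is differentiated only after it is known
    near the point. Directions such as [dd w h y] move with the point, which costs one extra term in
    each second derivative. The core is an equivalence at one point, for one chart of the unit
    bundle and one orthonormal frame. Each implication of the theorem then has to supply the object
    over which the other side quantifies: a chart around a given unit vector, or a frame around a
    given point. *)

Section Differentiability.
Context {R : realType} {V W : normedModType R}.
Implicit Types (f g : V -> W) (x v w : V).

(** The first-order expansion at [x] involves only values near [x], so the differential of [f]
    satisfies the expansion of [g]; uniqueness of differentials does the rest. *)
Lemma near_eq_differentiable f g x :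
  (\near x, f x = g x) -> differentiable f x -> differentiable g x.
Proof.
move=> fg df; apply/diff_locallyP.
have key : g \o shift x = cst (g x) + 'd f x +o_ 0 id.
  apply/eqaddoP => e e0.
  have /eqaddoP /(_ e e0) fo := diff_locally df.
  have fg0 : \forall h \near 0, f (h + x) = g (h + x).
    by move: (fg); rewrite (near_shift 0) subr0.
  near=> h.
  have -> : ((g \o shift x) - (cst (g x) + 'd f x)) h =
            ((f \o shift x) - (cst (f x) + 'd f x)) h.
    have e1 : f (h + x) = g (h + x) by near: h.
    by rewrite !fctE /= (nbhs_singleton fg) e1.
  by near: h.
have -> : 'd g x = 'd f x :> (V -> W).
  by apply: diff_unique => //; exact: diff_continuous.
by split => //; exact: diff_continuous.
Unshelve. all: by end_near. Qed.

Lemma derivative_linear f x : differentiable f x ->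
  forall a v w, 'D_(a *: v + w) f x = a *: 'D_v f x + 'D_w f x.
Proof. by move=> df a v w; rewrite !deriveE // linearP. Qed.

Lemma derivative_comp (Z : normedModType R) (h : W -> Z) f x v :
  differentiable f x -> differentiable h (f x) ->
  'D_v (h \o f) x = 'D_('D_v f x) h (f x).
Proof.
move=> df dh; rewrite !deriveE //; last exact: differentiable_comp.
by rewrite diff_comp.
Qed.


Lemma near_open (U : set V) x (P : V -> Prop) :
  open U -> U x -> (forall y, U y -> P y) -> \near x, P x.
Proof. by move=> oU Ux UP; near=> y; apply: UP; near: y; exact: open_nbhs_nbhs.
Unshelve. all: by end_near. Qed.

Lemma eq_derive_open (U : set V) f g v :
  open U -> (forall y, U y -> f y = g y) ->
  forall x, U x -> 'D_v f x = 'D_v g x.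
Proof. by move=> oU fg x Ux; apply: near_eq_derive; exact: near_open fg. Qed.

End Differentiability.

Section DifferentialOrder.
Context {R : realType} {V W : normedModType R}.
Implicit Types (U : set V) (f g : V -> W).

(** Smoothness quantifies over all lists of directions at once and offers no induction for products,
    quotients or composites. Bounding the length does: a derivative of order one of such an
    expression is an expression of the same kind, known one order lower. *)
Definition diff_upto (k : nat) U f : Prop :=
  forall vs x, (size vs <= k)%N -> U x -> differentiable (Defs.iterD vs f) x.

Lemma iterD_rcons vs (v : V) f :
  Defs.iterD (rcons vs v) f = Defs.iterD vs ('D_v f).
Proof. by rewrite /Defs.iterD foldr_rcons. Qed.

Lemma smooth_upto U f : smooth_on U f <-> forall k, diff_upto k U f.
Proof.
split=> [sf k vs x _|sf vs x]; first exact: sf.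
exact: (sf (size vs) vs x (leqnn _)).
Qed.

Lemma diff_upto0 k U f :
  diff_upto k U f -> forall x, U x -> differentiable f x.
Proof. by move=> sf x; exact: (sf [::]). Qed.

(** The derivative split off is the one taken first, the last of the list, so that what remains is
    again a condition on a single function ['D_v f]. *)
Lemma diff_uptoS k U f : diff_upto k.+1 U f <->
  (forall x, U x -> differentiable f x) /\ forall v, diff_upto k U ('D_v f).
Proof.
split=> [sf|[df sf] vs].
  split=> [x|v vs x vsk]; first exact: (sf [::]).
  by rewrite -iterD_rcons; apply: sf; rewrite size_rcons.
by case/lastP: vs => [x _ /=|vs v x]; [exact: df
  |rewrite size_rcons iterD_rcons; exact: sf].
Qed.

Lemma diff_upto_le k l U f : (k <= l)%N -> diff_upto l U f -> diff_upto k U f.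
Proof. by move=> kl sf vs x vsk; apply: sf; exact: leq_trans kl. Qed.

Lemma diff_uptoW k U f : diff_upto k.+1 U f -> diff_upto k U f.
Proof. exact: diff_upto_le. Qed.

Lemma eq_diff_upto k U f g : open U -> (forall y, U y -> f y = g y) ->
  diff_upto k U f -> diff_upto k U g.
Proof.
move=> oU; elim: k f g => [|k IH] f g fg sf.
  case=> // x _ Ux; apply: near_eq_differentiable (diff_upto0 sf Ux).
  exact: near_open fg.
case/diff_uptoS: sf => df sf; apply/diff_uptoS; split=> [x Ux|v].
  by apply: near_eq_differentiable (df x Ux); exact: near_open fg.
by apply: IH (sf v); exact: eq_derive_open.
Qed.

Lemma diff_upto_cst k U (a : W) : diff_upto k U (fun=> a).
Proof.
elim: k a => [|k IH] a; first by case=> // x _ _; exact: differentiable_cst.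
apply/diff_uptoS; split=> [x _|v]; first exact: differentiable_cst.
by rewrite (_ : 'D_v _ = fun=> 0) //; apply/funext => x; exact: derive_cst.
Qed.

Lemma diff_uptoD k U f g : open U -> diff_upto k U f -> diff_upto k U g ->
  diff_upto k U (fun x => f x + g x).
Proof.
move=> oU; elim: k f g => [|k IH] f g.
  move=> sf sg; case=> // x _ Ux.
  by apply: differentiableD; [exact: diff_upto0 sf x Ux
    |exact: diff_upto0 sg x Ux].
move=> /diff_uptoS[df sf] /diff_uptoS[dg sg]; apply/diff_uptoS;
  split=> [x Ux|v].
  by apply: differentiableD; [exact: df|exact: dg].
apply: eq_diff_upto (IH _ _ (sf v) (sg v)) => // x Ux.
by rewrite [RHS]deriveD //; apply: diff_derivable; [exact: df|exact: dg].
Qed.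

Lemma diff_upto_sum k U (I : Type) (r : seq I) (P : pred I) (f : I -> V -> W) :
  open U -> (forall i, diff_upto k U (f i)) ->
  diff_upto k U (fun x => \sum_(i <- r | P i) f i x).
Proof.
move=> oU sf; elim: r => [|i r IH].
  by under eq_fun do rewrite big_nil; exact: diff_upto_cst.
under eq_fun do rewrite big_cons.
by case: (P i) => //; exact: diff_uptoD.
Qed.

Lemma diff_upto_linear k U (L : {linear V -> W}) :
  continuous L -> diff_upto k U L.
Proof.
move=> cL; have dL x : differentiable L x by exact: linear_differentiable.
case: k => [|k]; first by case=> // x _ Ux.
apply/diff_uptoS; split=> // v.
rewrite (_ : 'D_v L = fun=> L v); first exact: diff_upto_cst.
by apply/funext => x; rewrite deriveE // diff_lin.
Qed.

End DifferentialOrder.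

Lemma diff_upto_linear_comp (R : realType) (V W Z : normedModType R) k
    (U : set V) (f : V -> W) (L : {linear W -> Z}) :
  open U -> continuous L -> diff_upto k U f -> diff_upto k U (L \o f).
Proof.
move=> oU cL; elim: k f => [|k IH] f.
  move=> sf; case=> // x _ Ux; apply: differentiable_comp.
    exact: diff_upto0 sf x Ux.
  exact: linear_differentiable.
move=> /diff_uptoS[df sf]; apply/diff_uptoS; split=> [x Ux|v].
  by apply: differentiable_comp; [exact: df|exact: linear_differentiable].
apply: eq_diff_upto (IH _ (sf v)) => // x Ux /=.
have dL : differentiable L (f x) by exact: linear_differentiable.
rewrite [RHS]derivative_comp //; last exact: df.
by rewrite [RHS]deriveE // diff_lin.
Qed.

Section ScalarOrder.
Context {R : realType} {V : normedModType R}.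
Implicit Types (U : set V) (f g : V -> R).

Lemma diff_uptoM k U f g : open U -> diff_upto k U f -> diff_upto k U g ->
  diff_upto k U (fun x => f x * g x).
Proof.
move=> oU; elim: k f g => [|k IH] f g.
  move=> sf sg; case=> // x _ Ux; apply: differentiableM.
    exact: diff_upto0 sf x Ux.
  exact: diff_upto0 sg x Ux.
move=> Sf Sg; have [df sf] := (diff_uptoS _ _ _).1 Sf.
have [dg sg] := (diff_uptoS _ _ _).1 Sg.
apply/diff_uptoS; split=> [x Ux|v].
  by apply: differentiableM; [exact: df|exact: dg].
apply: eq_diff_upto (diff_uptoD oU (IH _ _ (diff_uptoW Sf) (sg v))
                       (IH _ _ (diff_uptoW Sg) (sf v))) => // x Ux.
by rewrite [RHS]deriveM //; apply: diff_derivable; [exact: df|exact: dg].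
Qed.

(** The derivative [- f' / f ^ 2] contains the inverse of [f] itself, needed at order [k] only, so
    the induction closes. The square root below works alike, with derivative [f' / (2 sqrt f)]. *)
Lemma diff_uptoV k U f : open U -> (forall x, U x -> f x != 0) ->
  diff_upto k U f -> diff_upto k U (fun x => (f x)^-1).
Proof.
move=> oU f0; elim: k => [|k IH].
  move=> sf; case=> // x _ Ux.
  by apply: differentiableV; [exact: diff_upto0 sf x Ux|exact: f0].
move=> Sf; have [df sf] := (diff_uptoS _ _ _).1 Sf.
apply/diff_uptoS; split=> [x Ux|v].
  by apply: differentiableV; [exact: df|exact: f0].
have If := IH (diff_uptoW Sf).
have Nf := diff_uptoM oU (diff_upto_cst (-1 : R)) (sf v).
apply: eq_diff_upto (diff_uptoM oU Nf (diff_uptoM oU If If)) => // x Ux.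
rewrite [RHS]deriveV ?f0 //; last by apply: diff_derivable; exact: df.
by rewrite -exprVn expr2 /GRing.scale /=; ring.
Qed.

Lemma diff_upto_sqrt k U f : open U -> (forall x, U x -> 0 < f x) ->
  diff_upto k U f -> diff_upto k U (fun x => Num.sqrt (f x)).
Proof.
move=> oU f0.
have dsq x : U x -> differentiable (Num.sqrt : R -> R) (f x).
  by move=> Ux; apply/derivable1_diffP; have [] := is_derive1_sqrt (f0 _ Ux).
elim: k => [|k IH].
  move=> sf; case=> // x _ Ux; apply: differentiable_comp (dsq x Ux).
  exact: diff_upto0 sf x Ux.
move=> Sf; have [df sf] := (diff_uptoS _ _ _).1 Sf.
apply/diff_uptoS; split=> [x Ux|v].
  by apply: differentiable_comp (dsq x Ux); exact: df.
have sq0 x : U x -> 2 * Num.sqrt (f x) != 0.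
  by move=> Ux; rewrite mulf_neq0 // ?pnatr_eq0 // gt_eqF // sqrtr_gt0 f0.
have If := diff_uptoV oU sq0
  (diff_uptoM oU (diff_upto_cst (2 : R)) (IH (diff_uptoW Sf))).
apply: eq_diff_upto (diff_uptoM oU (sf v) If) => // x Ux.
rewrite [RHS]derivative_comp; [|exact: df|exact: dsq].
rewrite [RHS]deriveE; last exact: dsq.
have [dv dE] := is_derive1_sqrt (f0 _ Ux).
(* The direction is a real number, hence a multiple of 1, and the differential reduces to the usual
   derivative of the square root. *)
rewrite -[X in 'd _ _ X]mulr1 -[X in 'd _ _ X]/('D_v f x *: (1:R)) linearZ /=.
by rewrite -deriveE ?dE //; exact: dsq.
Qed.

End ScalarOrder.

Section MatrixOrder.
Context {R : realType} {V : normedModType R} {p q : nat}.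
Implicit Types (U : set V) (f g : V -> 'M[R]_(p, q)).

Lemma differentiable_mxP f x :
  differentiable f x <-> forall i j, differentiable (fun y => f y i j) x.
Proof.
split=> [df i j|df].
  pose coord := fun A : 'M[R]_(p, q) => A i j : R.
  apply: (@differentiable_comp _ _ _ _ f coord) => //.
  exact: differentiable_coord.
have -> : f = \sum_i \sum_j (fun y => f y i j *: delta_mx i j).
  apply/funext => y; rewrite fct_sumE [LHS]matrix_sum_delta.
  by apply: eq_bigr => i _; rewrite fct_sumE.
apply: differentiable_sum => i; apply: differentiable_sum => j.
by apply: differentiableZl; exact: df.
Qed.

Lemma derivative_coord f x v i j : differentiable f x ->
  ('D_v f x) i j = 'D_v (fun y => f y i j) x.
Proof. by move=> df; rewrite derive_mx ?mxE //; exact: diff_derivable. Qed.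

Lemma diff_upto_mxP k U f : open U ->
  diff_upto k U f <-> forall i j, diff_upto k U (fun y => f y i j).
Proof.
move=> oU; elim: k f => [|k IH] f.
  split=> sf; last first.
    case=> // x _ Ux; apply/differentiable_mxP => i j.
    exact: diff_upto0 (sf i j) x Ux.
  move=> i j [] // x _ Ux.
  by have /differentiable_mxP := diff_upto0 sf Ux; exact.
split=> [/diff_uptoS[df sf] i j|sf].
  apply/diff_uptoS; split=> [x Ux|v].
    by have /differentiable_mxP := df x Ux; exact.
  apply: eq_diff_upto ((IH _).1 (sf v) i j) => // x Ux.
  by rewrite -[RHS]derivative_coord //; exact: df.
have df x : U x -> differentiable f x.
  by move=> Ux; apply/differentiable_mxP => i j;
    exact: diff_upto0 (sf i j) x Ux.
apply/diff_uptoS; split=> // v; apply/IH => i j.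
have [_ sfv] := (diff_uptoS _ _ _).1 (sf i j).
apply: eq_diff_upto (sfv v) => // x Ux.
by rewrite -[LHS]derivative_coord //; exact: df.
Qed.

End MatrixOrder.

Section SmoothCalculus.
Context {R : realType} {V : normedModType R}.
Variable U : set V.
Hypothesis oU : open U.

Lemma smooth_derive (W : normedModType R) (f : V -> W) v :
  smooth_on U f -> smooth_on U ('D_v f).
Proof. by move=> sf vs x Ux; rewrite -iterD_rcons; exact: sf. Qed.

Lemma smooth_diff (W : normedModType R) (f : V -> W) :
  smooth_on U f -> forall x, U x -> differentiable f x.
Proof. by move=> sf x; exact: (sf [::]). Qed.

Lemma eq_smooth (W : normedModType R) (f g : V -> W) :
  (forall x, U x -> f x = g x) -> smooth_on U f -> smooth_on U g.
Proof.
move=> fg /smooth_upto sf; apply/smooth_upto => k.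
exact: eq_diff_upto oU fg (sf k).
Qed.

Lemma smooth_cst (W : normedModType R) (a : W) : smooth_on U (fun=> a).
Proof. by apply/smooth_upto => k; exact: diff_upto_cst. Qed.

Lemma smooth_linear (W : normedModType R) (L : {linear V -> W}) :
  continuous L -> smooth_on U L.
Proof. by move=> cL; apply/smooth_upto => k; exact: diff_upto_linear. Qed.

Lemma smooth_linear_comp (W Z : normedModType R) (f : V -> W)
    (L : {linear W -> Z}) :
  continuous L -> smooth_on U f -> smooth_on U (L \o f).
Proof.
move=> cL /smooth_upto sf; apply/smooth_upto => k.
exact: diff_upto_linear_comp.
Qed.

Lemma smoothD (W : normedModType R) (f g : V -> W) :
  smooth_on U f -> smooth_on U g -> smooth_on U (fun x => f x + g x).
Proof.
move=> /smooth_upto sf /smooth_upto sg; apply/smooth_upto => k.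
exact: diff_uptoD.
Qed.

Lemma smooth_sum (W : normedModType R) (I : Type) (r : seq I) (P : pred I)
    (f : I -> V -> W) :
  (forall i, smooth_on U (f i)) ->
  smooth_on U (fun x => \sum_(i <- r | P i) f i x).
Proof.
move=> sf; apply/smooth_upto => k; apply: diff_upto_sum => // i.
by have /smooth_upto := sf i; exact.
Qed.

Lemma smoothM (f g : V -> R) :
  smooth_on U f -> smooth_on U g -> smooth_on U (fun x => f x * g x).
Proof.
move=> /smooth_upto sf /smooth_upto sg; apply/smooth_upto => k.
exact: diff_uptoM.
Qed.

Lemma smooth_prod (I : Type) (r : seq I) (P : pred I) (f : I -> V -> R) :
  (forall i, smooth_on U (f i)) ->
  smooth_on U (fun x => \prod_(i <- r | P i) f i x).
Proof.
move=> sf; elim: r => [|i r IH].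
  by under eq_fun do rewrite big_nil; exact: smooth_cst.
under eq_fun do rewrite big_cons.
by case: (P i) => //; exact: smoothM.
Qed.

Lemma smoothV (f : V -> R) : (forall x, U x -> f x != 0) ->
  smooth_on U f -> smooth_on U (fun x => (f x)^-1).
Proof.
move=> f0 /smooth_upto sf; apply/smooth_upto => k.
exact: diff_uptoV.
Qed.

Lemma smooth_sqrt (f : V -> R) : (forall x, U x -> 0 < f x) ->
  smooth_on U f -> smooth_on U (fun x => Num.sqrt (f x)).
Proof.
move=> f0 /smooth_upto sf; apply/smooth_upto => k.
exact: diff_upto_sqrt.
Qed.

Lemma smooth_mxP p q (f : V -> 'M[R]_(p, q)) :
  smooth_on U f <-> forall i j, smooth_on U (fun x => f x i j).
Proof.
split=> [/smooth_upto sf i j|sf]; apply/smooth_upto => k.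
  exact: ((diff_upto_mxP k f oU).1 (sf k)).
by apply/diff_upto_mxP => // i j; have /smooth_upto := sf i j; exact.
Qed.

Lemma smoothN (W : normedModType R) (f : V -> W) :
  smooth_on U f -> smooth_on U (fun x => - f x).
Proof.
move=> sf; have sN : continuous (-%R : W -> W) by exact: opp_continuous.
exact: (@smooth_linear_comp W W f (-%R : {linear W -> W}) sN sf).
Qed.

Lemma smooth_scale p q (a : V -> R) (f : V -> 'M[R]_(p, q)) :
  smooth_on U a -> smooth_on U f -> smooth_on U (fun x => a x *: f x).
Proof.
move=> sa /smooth_mxP sf; apply/smooth_mxP => i j.
by under eq_fun do rewrite mxE; exact: smoothM.
Qed.

Lemma smooth_row_mx m p q (f : V -> 'M[R]_(m, p)) (g : V -> 'M[R]_(m, q)) :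
  smooth_on U f -> smooth_on U g -> smooth_on U (fun x => row_mx (f x) (g x)).
Proof.
move=> /smooth_mxP sf /smooth_mxP sg; apply/smooth_mxP => i j.
case: (split_ordP j) => k ->.
  by under eq_fun do rewrite row_mxEl; exact: sf.
by under eq_fun do rewrite row_mxEr; exact: sg.
Qed.

Lemma smooth_lsubmx m p q (f : V -> 'M[R]_(m, p + q)) :
  smooth_on U f -> smooth_on U (fun x => lsubmx (f x)).
Proof.
move=> /smooth_mxP sf; apply/smooth_mxP => i j.
by under eq_fun do rewrite mxE; exact: sf.
Qed.

Lemma smooth_rsubmx m p q (f : V -> 'M[R]_(m, p + q)) :
  smooth_on U f -> smooth_on U (fun x => rsubmx (f x)).
Proof.
move=> /smooth_mxP sf; apply/smooth_mxP => i j.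
by under eq_fun do rewrite mxE; exact: sf.
Qed.

Lemma smooth_det p (f : V -> 'M[R]_p) :
  smooth_on U f -> smooth_on U (fun x => \det (f x)).
Proof.
move=> /smooth_mxP sf; apply: smooth_sum => s.
by apply: smoothM; [exact: smooth_cst|exact: smooth_prod].
Qed.

(** Cramer's rule: the entries are polynomials in those of [f] divided by the determinant. *)
Lemma smooth_invmx p (f : V -> 'M[R]_p) :
  (forall x, U x -> f x \in unitmx) ->
  smooth_on U f -> smooth_on U (fun x => invmx (f x)).
Proof.
move=> uf sf.
apply: (@eq_smooth _ (fun x => (\det (f x))^-1 *: \adj (f x))).
  by move=> x Ux; rewrite /invmx uf.
apply: smooth_scale.
  by apply: smoothV (smooth_det sf) => x /uf; rewrite unitmxE unitfE.
have /smooth_mxP sfc := sf.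
apply/smooth_mxP => i j; under eq_fun do rewrite mxE.
apply: smoothM; first exact: smooth_cst.
apply: smooth_det; apply/smooth_mxP => k l.
by under eq_fun do rewrite !mxE; exact: sfc.
Qed.

End SmoothCalculus.

Lemma smooth_sub (R : realType) (V W : normedModType R) (U U' : set V)
    (f : V -> W) : U' `<=` U -> smooth_on U f -> smooth_on U' f.
Proof. by move=> UU' sf vs x /UU'; exact: sf. Qed.

Lemma rV_sum_dx (R : realType) n (v : 'rV[R]_n) :
  v = \sum_i v 0 i *: dx i.
Proof. by rewrite [LHS]row_sum_delta. Qed.

Lemma derivative_sum_dx (R : realType) n (W : normedModType R)
    (f : 'rV[R]_n -> W) x v : differentiable f x ->
  'D_v f x = \sum_i v 0 i *: 'D_(dx i) f x.
Proof.
move=> df; rewrite {1}(rV_sum_dx v) deriveE // linear_sum.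
by apply: eq_bigr => i _; rewrite linearZ /= deriveE.
Qed.

Section SmoothComposition.
Context {R : realType} {V : normedModType R} {m : nat}.
Variables (U : set V) (O : set 'rV[R]_m).
Hypotheses (oU : open U) (oO : open O).
Variable f : V -> 'rV[R]_m.
Hypotheses (sf : smooth_on U f) (fUO : forall x, U x -> O (f x)).

(** In the chain rule the direction ['D_v f x] varies with [x]. Expanding it over the basis leaves
    partial derivatives of [h] in fixed directions, composed with [f], to which the induction
    hypothesis applies. *)
Lemma diff_upto_comp_scalar k (h : 'rV[R]_m -> R) :
  diff_upto k O h -> diff_upto k U (h \o f).
Proof.
have df := smooth_diff sf.
elim: k h => [|k IH] h.
  move=> sh; case=> // x _ Ux; apply: differentiable_comp; first exact: df.
  by apply: diff_upto0 sh _ _; exact: fUO.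
move=> /diff_uptoS[dh sh]; apply/diff_uptoS; split=> [x Ux|v].
  by apply: differentiable_comp; [exact: df|apply: dh; exact: fUO].
apply: (@eq_diff_upto _ _ _ _ _
  (fun x => \sum_j ('D_v f x) 0 j * ('D_(dx j) h \o f) x)) => // [x Ux|].
  rewrite [RHS]derivative_comp; [|exact: df|apply: dh; exact: fUO].
  by rewrite [RHS]derivative_sum_dx //; apply: dh; exact: fUO.
have sfv j : diff_upto k U (fun x => ('D_v f x) 0 j).
  have /(smooth_mxP oU) sfv := smooth_derive v sf.
  by have /smooth_upto := sfv 0 j; exact.
apply: diff_upto_sum => // j; apply: diff_uptoM => //.
exact: IH (sh _).
Qed.

Lemma smooth_comp p q (h : 'rV[R]_m -> 'M[R]_(p, q)) :
  smooth_on O h -> smooth_on U (h \o f).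
Proof.
move=> /(smooth_mxP oO) sh; apply/(smooth_mxP oU) => i j.
apply/smooth_upto => k.
apply: (@diff_upto_comp_scalar k (fun x => h x i j)).
by have /smooth_upto := sh i j; exact.
Qed.

Lemma smooth_comp_scalar (h : 'rV[R]_m -> R) :
  smooth_on O h -> smooth_on U (h \o f).
Proof.
move=> /smooth_upto sh; apply/smooth_upto => k.
exact: diff_upto_comp_scalar.
Qed.

End SmoothComposition.

(** * Symmetry of second derivatives *)

Lemma dist_half_lt (R : realFieldType) (e p q r : R) :
  `|p - r| < e / 2 -> `|q - r| < e / 2 -> `|p - q| <= e.
Proof.
move=> pr qr; apply: le_trans (ler_distD r p q) _.
by rewrite [leRHS]splitr lerD // ?[`|r - q|]distrC ltW.
Qed.

Section Schwarz.
Context {R : realType} {V : normedModType R}.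
Variable U : set V.
Hypothesis oU : open U.

Lemma is_derive_line (f : V -> R) (c v : V) (s : R) :
  differentiable f (c + s *: v) ->
  is_derive s 1 (fun t : R => f (c + t *: v)) ('D_v f (c + s *: v)).
Proof.
move=> df; pose l := fun t : R => c + t *: v.
have dl (t : R) : is_derive t 1 l v.
  have := @is_deriveD _ _ _ (cst c) (fun t : R => t *: v) t 1 0 v.
  rewrite add0r; apply; split.
    by apply: diff_derivable; exact: differentiableZl.
  by rewrite deriveE ?diff_val ?scale1r //; exact: differentiableZl.
have dlx : differentiable l s by apply/derivable1_diffP; have [] := dl s.
split; first by apply: diff_derivable; exact: differentiable_comp dlx df.
rewrite -[LHS]/('D_1 (f \o l) s) (derivative_comp _ dlx df).
by have [_ ->] := dl s.
Qed.

(** The mean value theorem twice: along [v] for the difference of [f] on two parallel segments, then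
    along [w] for ['D_v f]. *)
Lemma second_difference (f : V -> R) (x v w : V) (h : R) : 0 < h ->
  smooth_on U f ->
  (forall s t, 0 <= s <= h -> 0 <= t <= h -> U (x + s *: v + t *: w)) ->
  exists a b, [/\ 0 <= a <= h, 0 <= b <= h &
   f (x + h *: v + h *: w) - f (x + h *: v) - f (x + h *: w) + f x =
   h ^+ 2 * 'D_w ('D_v f) (x + a *: v + b *: w)].
Proof.
move=> h0 sf box.
have hh : 0 <= h <= h by rewrite lexx ltW.
have h00 : (0 : R) <= 0 <= h by rewrite lexx ltW.
pose g s := f (x + h *: w + s *: v) - f (x + s *: v).
have dg s : 0 <= s <= h -> is_derive s 1 g
    ('D_v f (x + h *: w + s *: v) - 'D_v f (x + s *: v)).
  move=> sh; apply: is_deriveB; apply: is_derive_line;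
    apply: smooth_diff sf _ _.
    by rewrite addrAC; exact: box.
  by have := box s 0 sh h00; rewrite scale0r addr0.
have [a aI|a|a] := @MVT R g
    (fun s => 'D_v f (x + h *: w + s *: v) - 'D_v f (x + s *: v)) 0 h h0.
- by apply: dg; move: aI; rewrite in_itv /= => /andP[/ltW -> /ltW ->].
- apply: derivable_within_continuous => y; rewrite in_itv /= => yh.
  by have [] := dg y yh.
rewrite in_itv /= => /andP[/ltW a0 /ltW ah]; rewrite subr0 => ga.
have aI : 0 <= a <= h by rewrite a0.
pose k t := 'D_v f (x + a *: v + t *: w).
have dk t : 0 <= t <= h ->
    is_derive t 1 k ('D_w ('D_v f) (x + a *: v + t *: w)).
  move=> th; apply: is_derive_line; apply: smooth_diff (smooth_derive v sf) _ _.
  exact: box.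
have [b bI|b|b] := @MVT R k
    (fun t => 'D_w ('D_v f) (x + a *: v + t *: w)) 0 h h0.
- by apply: dk; move: bI; rewrite in_itv /= => /andP[/ltW -> /ltW ->].
- apply: derivable_within_continuous => y; rewrite in_itv /= => yh.
  by have [] := dk y yh.
rewrite in_itv /= => /andP[/ltW b0 /ltW bh]; rewrite subr0 => kb.
exists a, b; split; rewrite ?b0 ?a0 //.
move: kb ga; rewrite /k /g !scale0r !addr0 (addrAC x (a *: v)) => ->.
rewrite [x + h *: w + _]addrAC => e.
rewrite mulrC expr2; apply: etrans (etrans e _); first by ring.
by rewrite -mulrA.
Qed.

Lemma near_dist_lt (f : V -> R) (x : V) (e : R) :
  differentiable f x -> 0 < e -> \forall y \near x, `|f x - f y| < e.
Proof. by move=> /differentiable_continuous /cvgrPdist_lt; exact. Qed.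

(** The second difference is symmetric in [v] and [w], so the two mixed derivatives take a common
    value at two points of a small parallelogram; both are continuous at [x]. *)
Lemma schwarz_scalar (f : V -> R) (x v w : V) : U x -> smooth_on U f ->
  'D_v ('D_w f) x = 'D_w ('D_v f) x.
Proof.
move=> Ux sf.
set A := 'D_v ('D_w f); set B := 'D_w ('D_v f).
apply/eqP; rewrite -subr_eq0 -normr_le0; apply/ler_addgt0Pl => e e0.
rewrite addr0.
have dA : differentiable A x.
  by apply: smooth_diff (smooth_derive v (smooth_derive w sf)) _ Ux.
have dB : differentiable B x.
  by apply: smooth_diff (smooth_derive w (smooth_derive v sf)) _ Ux.
have e2 : 0 < e / 2 by rewrite divr_gt0.
have nA : \forall y \near x, `|A x - A y| < e / 2 := near_dist_lt dA e2.
have nB : \forall y \near x, `|B x - B y| < e / 2 := near_dist_lt dB e2.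
have nU : \forall y \near x, U y by exact: open_nbhs_nbhs.
have /nbhs_ballP[d /= d0 dP] : nbhs x (U `&`
    ([set y | `|A x - A y| < e / 2] `&` [set y | `|B x - B y| < e / 2])).
  exact: filterI nU (filterI nA nB).
(* Displacements in the parallelogram have norm at most [h * (|v| + |w|)], hence less than [d]. The
   summand 1 keeps the denominator positive when both directions vanish. *)
pose h := d / 2 / (1 + `|v| + `|w|).
have N0 : 0 < 1 + `|v| + `|w| by rewrite -addrA ltr_pwDl ?addr_ge0.
have h0 : 0 < h by rewrite !divr_gt0.
have box s t : 0 <= s <= h -> 0 <= t <= h -> ball x d (x + s *: v + t *: w).
  move=> /andP[s0 sh] /andP[t0 th].
  rewrite -ball_normE /= -addrA opprD addNKr normrN.
  apply: le_lt_trans (ler_normD _ _) _; rewrite !normrZ !ger0_norm //.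
  apply: (@le_lt_trans _ _ (h * (1 + `|v| + `|w|))); last first.
    by rewrite /h divfK ?gt_eqF // gtr_pMr // invf_lt1 // ltr1n.
  rewrite mulrDr mulrDr mulr1 -addrA; apply: ler_wpDl; first exact: ltW.
  by apply: lerD; exact: ler_wpM2r.
have [a [b [aI bI e1]]] :=
  second_difference h0 sf (fun s t sI tI => (dP _ (box s t sI tI)).1).
have box' s t : 0 <= s <= h -> 0 <= t <= h -> ball x d (x + s *: w + t *: v).
  by move=> sI tI; rewrite addrAC; exact: box.
have [a' [b' [aI' bI' e3]]] :=
  second_difference h0 sf (fun s t sI tI => (dP _ (box' s t sI tI)).1).
have AB : A (x + a' *: w + b' *: v) = B (x + a *: v + b *: w).
  have h20 : h ^+ 2 != 0 by rewrite expf_neq0 // gt_eqF.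
  apply: (mulfI h20); rewrite -[LHS]e3 -[RHS]e1 [x + h *: w + _]addrAC; ring.
have [_ [A1 _]] := dP _ (box' _ _ aI' bI').
have [_ [_ B1]] := dP _ (box _ _ aI bI).
move: A1; rewrite /= AB => A1.
exact: dist_half_lt A1 B1.
Qed.

Lemma schwarz p q (f : V -> 'M[R]_(p, q)) (x v w : V) : U x -> smooth_on U f ->
  'D_v ('D_w f) x = 'D_w ('D_v f) x.
Proof.
move=> Ux sf; apply/matrixP => i j.
have E a b : ('D_a ('D_b f) x) i j = 'D_a ('D_b (fun y => f y i j)) x.
  rewrite derivative_coord; last first.
    by apply: smooth_diff (smooth_derive b sf) _ Ux.
  apply: eq_derive_open Ux => // y Uy.
  by rewrite derivative_coord //; exact: smooth_diff sf _ Uy.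
apply: etrans (E v w) (etrans _ (esym (E w v))).
apply: (@schwarz_scalar (fun y => f y i j)) => //.
by have /(smooth_mxP oU) := sf; exact.
Qed.

End Schwarz.

(* Comparing two directional derivatives by conversion unfolds them down to
   limits, which does not end in practice; dd is an opaque copy of 'D. *)
Fact derivative_copy (R : realType) (V W : normedModType R) :
  {D : V -> (V -> W) -> V -> W | forall v f, D v f = 'D_v f}.
Proof. by exists (fun v f => 'D_v f). Qed.

Definition dd (R : realType) (V W : normedModType R) (v : V) (f : V -> W) :
  V -> W := sval (derivative_copy V W) v f.

Lemma ddE (R : realType) (V W : normedModType R) (v : V) (f : V -> W) :
  dd v f = 'D_v f.
Proof. exact: svalP (derivative_copy V W) v f. Qed.

Section OpaqueDerivative.
Context {R : realType} {V W : normedModType R}.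
Implicit Types (f g : V -> W) (x v w : V).

Lemma near_eq_dd f g x v : (\near x, f x = g x) -> dd v f x = dd v g x.
Proof. by rewrite !ddE; exact: near_eq_derive. Qed.

Lemma dd_linear f x : differentiable f x ->
  forall a v w, dd (a *: v + w) f x = a *: dd v f x + dd w f x.
Proof. by move=> df a v w; rewrite !ddE; exact: derivative_linear. Qed.

Lemma dd_comp (Z : normedModType R) (h : W -> Z) f x v :
  differentiable f x -> differentiable h (f x) ->
  dd v (h \o f) x = dd (dd v f x) h (f x).
Proof. by rewrite !ddE; exact: derivative_comp. Qed.

Lemma dd_cst (a : W) x v : dd v (fun=> a) x = 0.
Proof. by rewrite ddE; exact: derive_cst. Qed.

Lemma dd_id (x v : V) : dd v id x = v.
Proof. by rewrite ddE; exact: derive_id. Qed.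

Lemma ddD f g x v : differentiable f x -> differentiable g x ->
  dd v (fun y => f y + g y) x = dd v f x + dd v g x.
Proof.
by move=> df dg; rewrite !ddE [LHS]deriveD //; exact: diff_derivable.
Qed.

Lemma smooth_dd (U : set V) f v :
  smooth_on U f -> smooth_on U (dd v f).
Proof. by rewrite ddE; exact: smooth_derive. Qed.

End OpaqueDerivative.

Lemma dd_sum_dx (R : realType) n (W : normedModType R)
    (f : 'rV[R]_n -> W) x v : differentiable f x ->
  dd v f x = \sum_i v 0 i *: dd (dx i) f x.
Proof.
by move=> df; under eq_bigr do rewrite ddE; rewrite ddE;
  exact: derivative_sum_dx.
Qed.

Lemma schwarz_dd (R : realType) (V : normedModType R) (U : set V) p q
    (f : V -> 'M[R]_(p, q)) (x v w : V) :
  open U -> U x -> smooth_on U f -> dd v (dd w f) x = dd w (dd v f) x.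
Proof. by move=> oU Ux sf; rewrite !ddE; exact: (schwarz oU v w Ux sf). Qed.

Lemma schwarz_dd_scalar (R : realType) (V : normedModType R) (U : set V)
    (f : V -> R) (x v w : V) :
  open U -> U x -> smooth_on U f -> dd v (dd w f) x = dd w (dd v f) x.
Proof.
by move=> oU Ux sf; rewrite !ddE; exact: (schwarz_scalar oU v w Ux sf).
Qed.

(** * The Levi-Civita connection along a map *)

Section LinearMap.
Context {R : realType} {n : nat} {W : lmodType R}.
Implicit Types f g : 'rV[R]_n -> W.

Definition linear_map f : Prop :=
  forall (c : R) v w, f (c *: v + w) = c *: f v + f w.

Lemma linear_map_sum f v : linear_map f -> f v = \sum_i v 0 i *: f (dx i).
Proof.
move=> lf; have f0 : f 0 = 0.
  by have := lf (-1) 0 0; rewrite scaler0 addr0 scaleN1r addNr.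
rewrite [in LHS](rV_sum_dx v).
elim/big_rec2 : _ => [//|i y1 y2 _ <-]; exact: lf.
Qed.

Lemma linear_map_ext f g : linear_map f -> linear_map g ->
  (forall i, f (dx i) = g (dx i)) -> forall v, f v = g v.
Proof.
move=> lf lg fg v; rewrite (linear_map_sum v lf) (linear_map_sum v lg).
by apply: eq_bigr => i _; rewrite fg.
Qed.

End LinearMap.

Section Bilinear.
Context {R : realType} {n : nat}.
Implicit Types (A : 'M[R]_n) (v w a : 'rV[R]_n).

Lemma dotE A v w : dot A v w = \sum_i \sum_j v 0 i * A i j * w 0 j.
Proof.
rewrite /dot mxE exchange_big /=; apply: eq_bigr => j _.
by rewrite !mxE big_distrl.
Qed.

Lemma dotDl A v w a : dot A (v + w) a = dot A v a + dot A w a.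
Proof. by rewrite /dot !mulmxDl mxE. Qed.

Lemma dotDr A v w a : dot A a (v + w) = dot A a v + dot A a w.
Proof. by rewrite /dot linearD /= mulmxDr mxE. Qed.

Lemma dotZl A (c : R) v w : dot A (c *: v) w = c * dot A v w.
Proof. by rewrite /dot -!scalemxAl mxE. Qed.

Lemma dotZr A (c : R) v w : dot A v (c *: w) = c * dot A v w.
Proof. by rewrite /dot linearZ /= -!scalemxAr mxE. Qed.

Lemma dotDl_mx A B v w : dot (A + B) v w = dot A v w + dot B v w.
Proof. by rewrite /dot mulmxDr mulmxDl mxE. Qed.

Lemma dotZl_mx (c : R) A v w : dot (c *: A) v w = c * dot A v w.
Proof. by rewrite /dot -scalemxAr -scalemxAl mxE. Qed.

Lemma dotNl A v w : dot A (- v) w = - dot A v w.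
Proof. by rewrite -scaleN1r dotZl mulN1r. Qed.

Lemma dotNr A v w : dot A v (- w) = - dot A v w.
Proof. by rewrite -scaleN1r dotZr mulN1r. Qed.

Lemma dotBl A v w a : dot A (v - w) a = dot A v a - dot A w a.
Proof. by rewrite dotDl dotNl. Qed.

Lemma dotBr A v w a : dot A a (v - w) = dot A a v - dot A a w.
Proof. by rewrite dotDr dotNr. Qed.

Lemma dot_suml A (I : finType) (f : I -> 'rV[R]_n) w :
  dot A (\sum_i f i) w = \sum_i dot A (f i) w.
Proof.
elim/big_rec2: _ => [|i y1 y2 _ <-]; first exact: dot0l.
by rewrite dotDl.
Qed.

Lemma dot_sumr A (I : finType) (f : I -> 'rV[R]_n) w :
  dot A w (\sum_i f i) = \sum_i dot A w (f i).
Proof.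
elim/big_rec2: _ => [|i y1 y2 _ <-]; first exact: dot0r.
by rewrite dotDr.
Qed.

Lemma dotC A v w : A^T = A -> dot A v w = dot A w v.
Proof.
move=> sA; rewrite /dot -[in LHS](trmxK (v *m A *m w^T)) mxE.
by rewrite !trmx_mul trmxK sA mulmxA.
Qed.

Lemma dot_dx A i j : dot A (dx i) (dx j) = A i j.
Proof. by rewrite /dot /dx -rowE trmx_delta -colE !mxE. Qed.

Variable G : 'rV[R]_n -> 'M[R]_n.

Lemma GamDl x v w a : Gam G x (v + w) a = Gam G x v a + Gam G x w a.
Proof.
apply/rowP => k; rewrite !mxE -big_split; apply: eq_bigr => i _ /=.
rewrite -big_split; apply: eq_bigr => j _ /=.
by rewrite mxE mulrDr mulrDl.
Qed.

Lemma GamZl x (c : R) v w : Gam G x (c *: v) w = c *: Gam G x v w.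
Proof.
apply/rowP => k; rewrite !mxE mulr_sumr; apply: eq_bigr => i _ /=.
rewrite mulr_sumr; apply: eq_bigr => j _ /=.
by rewrite mxE; ring.
Qed.

Lemma GamDr x v w a : Gam G x a (v + w) = Gam G x a v + Gam G x a w.
Proof.
apply/rowP => k; rewrite !mxE -big_split; apply: eq_bigr => i _ /=.
rewrite -big_split; apply: eq_bigr => j _ /=.
by rewrite mxE mulrDr.
Qed.

Lemma GamZr x (c : R) v w : Gam G x v (c *: w) = c *: Gam G x v w.
Proof.
apply/rowP => k; rewrite !mxE mulr_sumr; apply: eq_bigr => i _ /=.
rewrite mulr_sumr; apply: eq_bigr => j _ /=.
by rewrite mxE; ring.
Qed.

Lemma GamC x v w : (forall y, (G y)^T = G y) -> Gam G x v w = Gam G x w v.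
Proof.
move=> sG; apply/rowP => k; rewrite !mxE exchange_big /=.
apply: eq_bigr => i _; apply: eq_bigr => j _.
by rewrite christoffel_torsion_free // mulrAC.
Qed.

End Bilinear.

Section ProductRules.
Context {R : realType} {V : normedModType R}.

Lemma is_derive_bigsum (I : finType) (h : I -> V -> R) (dh : I -> R) x v :
  (forall i, is_derive x v (h i) (dh i)) ->
  is_derive x v (fun y => \sum_i h i y) (\sum_i dh i).
Proof.
move=> hd; pose e (f : V -> R) (d : R) := is_derive x v f d.
rewrite -/(e _ _) -fct_sumE.
elim/big_rec2 : _ => [|i d f _ fd]; first exact: is_derive_cst.
exact: is_deriveD.
Qed.

Lemma is_derive_prod3 (f g h : V -> R) x v df dg dh :
  is_derive x v f df -> is_derive x v g dg -> is_derive x v h dh ->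
  is_derive x v (fun y => f y * g y * h y)
    (df * g x * h x + f x * dg * h x + f x * g x * dh).
Proof.
move=> fd gd hd.
have fgd : is_derive x v (f \* g) (f x *: dg + g x *: df) by exact: is_deriveM.
have := is_deriveM fgd hd.
move=> [? e]; split=> //; rewrite [LHS]e /GRing.scale /=; ring.
Qed.

Lemma is_derive_coord p q (f : V -> 'M[R]_(p, q)) x v i j :
  differentiable f x -> is_derive x v (fun y => f y i j) (('D_v f x) i j).
Proof.
move=> df; split; last by rewrite derivative_coord.
by apply: diff_derivable; have /differentiable_mxP := df; exact.
Qed.

Context {n : nat}.

Lemma dd_dot (A : V -> 'M[R]_n) (Y Z : V -> 'rV[R]_n) x v :
  differentiable A x -> differentiable Y x -> differentiable Z x ->
  dd v (fun y => dot (A y) (Y y) (Z y)) x =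
  dot (dd v A x) (Y x) (Z x) + dot (A x) (dd v Y x) (Z x)
  + dot (A x) (Y x) (dd v Z x).
Proof.
move=> dA dY dZ; rewrite !ddE.
have [_ e] : is_derive x v (fun y => \sum_i \sum_j Y y 0 i * A y i j * Z y 0 j)
    (\sum_i \sum_j (('D_v Y x) 0 i * A x i j * Z x 0 j
      + Y x 0 i * ('D_v A x) i j * Z x 0 j
      + Y x 0 i * A x i j * ('D_v Z x) 0 j)).
  apply: is_derive_bigsum => i; apply: is_derive_bigsum => j.
  by apply: is_derive_prod3; exact: is_derive_coord.
have -> : (fun y => dot (A y) (Y y) (Z y)) =
    fun y => \sum_i \sum_j Y y 0 i * A y i j * Z y 0 j.
  by apply/funext => y; exact: dotE.
rewrite [LHS]e !dotE -!big_split /=; apply: eq_bigr => i _.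
by rewrite -!big_split /=; apply: eq_bigr => j _; ring.
Qed.

End ProductRules.

Section ConnectionAlong.
Context {R : realType} {n : nat}.
Local Notation E := 'rV[R]_n.
Variables (G : E -> 'M[R]_n) (U : set E).
Hypotheses (oU : open U) (sG : forall x, (G x)^T = G x).
Hypotheses (smG : smooth_on U G) (uG : forall x, U x -> G x \in unitmx).

Lemma smooth_christoffel k i j : smooth_on U (fun x => christoffel G x k i j).
Proof.
have sdG a b c : smooth_on U (dG G a b c).
  by apply: smooth_derive; have /smooth_mxP := smG; exact.
have /(smooth_mxP oU) siG := smooth_invmx oU uG smG.
apply: smoothM => //; first exact: smooth_cst.
apply: smooth_sum => // l; apply: smoothM => //.
apply: smoothD => //; first exact: smoothD.
exact: smoothN.
Qed.

(** Both sides are linear in each of [v], [w] and [a]; on basis vectors the identity is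
    [christoffel_metric]. *)
Lemma metric_compat x v w a : U x ->
  dot (dd v G x) w a = dot (G x) (Gam G x v w) a + dot (G x) w (Gam G x v a).
Proof.
move=> Ux; have dGx : differentiable G x by exact: smooth_diff smG _ Ux.
rewrite ddE.
have GamE k i l : Gam G x (dx k) (dx i) 0 l = christoffel G x l k i.
  rewrite mxE (bigD1 k) //= [X in _ + X]big1 ?addr0 => [|k' kk']; last first.
    by rewrite big1 // => i' _; rewrite !mxE eqxx (negbTE kk') /= mulr0 mul0r.
  rewrite (bigD1 i) //= [X in _ + X]big1 ?addr0 => [|i' ii']; last first.
    by rewrite !mxE eqxx (negbTE ii') /= mulr0.
  by rewrite !mxE !eqxx /= !mulr1.
pose F (v w a : E) := dot (G x) (Gam G x v w) a + dot (G x) w (Gam G x v a).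
rewrite -/(F v w a).
have lv w' a' : linear_map (fun v => dot ('D_v G x) w' a').
  by move=> c v1 v2; rewrite (derivative_linear dGx) dotDl_mx dotZl_mx.
have lFv w' a' : linear_map (F ^~ w' ^~ a').
  move=> c v1 v2; rewrite /F !GamDl !GamZl dotDl dotDr dotZl dotZr.
  by rewrite /GRing.scale /=; ring.
have lw (A : 'M[R]_n) a' : linear_map (dot A ^~ a').
  by move=> c v1 v2; rewrite dotDl dotZl.
have la (A : 'M[R]_n) w' : linear_map (dot A w').
  by move=> c v1 v2; rewrite dotDr dotZr.
have lFw v' a' : linear_map (F v' ^~ a').
  move=> c v1 v2; rewrite /F !GamDr !GamZr !dotDl !dotZl.
  by rewrite /GRing.scale /=; ring.
have lFa v' w' : linear_map (F v' w').
  move=> c v1 v2; rewrite /F !GamDr !GamZr !dotDr !dotZr.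
  by rewrite /GRing.scale /=; ring.
apply: (linear_map_ext (lv w a) (lFv w a)) => k.
apply: (linear_map_ext (lw _ a) (lFw (dx k) a)) => i.
apply: (linear_map_ext (la _ (dx i)) (lFa (dx k) (dx i))) => j.
rewrite dot_dx derivative_coord // -/(dG G k i j x).
rewrite (@christoffel_metric _ _ G x k i j sG (uG Ux)) big_split /F /=.
congr (_ + _).
  rewrite dotE; apply: eq_bigr => l _; rewrite GamE.
  rewrite (bigD1 j) //= [X in _ + X]big1 ?addr0 => [|j' jj']; last first.
    by rewrite !mxE (negbTE jj') /= mulr0.
  by rewrite !mxE !eqxx mulr1.
rewrite (dotC _ _ (sG x)) dotE; apply: eq_bigr => l _; rewrite GamE.
rewrite (bigD1 i) //= [X in _ + X]big1 ?addr0 => [|i' ii']; last first.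
  by rewrite !mxE (negbTE ii') /= mulr0.
by rewrite !mxE !eqxx mulr1 -[in RHS](sG x) mxE.
Qed.

(** The Koszul formula on constant fields, whose brackets vanish. It is applied below to the metric
    of the unit bundle, and gives access to its Christoffel symbols through pairings alone. *)
Lemma koszul x v w a : U x -> dot (G x) (Gam G x v w) a =
  2^-1 * (dot (dd v G x) w a + dot (dd w G x) v a - dot (dd a G x) v w).
Proof.
move=> Ux; rewrite !metric_compat //.
rewrite (GamC _ w v sG) (GamC _ a v sG) (GamC _ a w sG) (dotC w _ (sG x)).
by field.
Qed.

Definition dGam (x u v w : E) : E := \row_k \sum_i \sum_j
  dd u (fun x => christoffel G x k i j) x * v 0 i * w 0 j.

Section AlongMap.
Context {V : normedModType R}.
Implicit Types (b Y Z : V -> E).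

Lemma dd_Gam b Y Z y v :
  U (b y) -> differentiable b y -> differentiable Y y -> differentiable Z y ->
  dd v (fun y => Gam G (b y) (Y y) (Z y)) y =
  dGam (b y) (dd v b y) (Y y) (Z y)
  + Gam G (b y) (dd v Y y) (Z y) + Gam G (b y) (Y y) (dd v Z y).
Proof.
move=> Uby db dY dZ; rewrite !ddE.
have dc k i j : differentiable (fun x => christoffel G x k i j) (b y).
  exact: smooth_diff (smooth_christoffel k i j) _ Uby.
have H k : is_derive y v (fun y => Gam G (b y) (Y y) (Z y) 0 k)
    (\sum_i \sum_j (
     'D_('D_v b y) (fun x => christoffel G x k i j) (b y) * Y y 0 i * Z y 0 j
     + christoffel G (b y) k i j * ('D_v Y y) 0 i * Z y 0 j
     + christoffel G (b y) k i j * Y y 0 i * ('D_v Z y) 0 j)).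
  under eq_fun do rewrite mxE.
  apply: is_derive_bigsum => i; apply: is_derive_bigsum => j.
  apply: is_derive_prod3; [|exact: is_derive_coord|exact: is_derive_coord].
  split; last exact: (derivative_comp v db (dc k i j)).
  by apply: diff_derivable; exact: (differentiable_comp db (dc k i j)).
have dB : derivable (fun y => Gam G (b y) (Y y) (Z y)) y v.
  by apply/derivable_mxP => i k; rewrite (ord1 i); have [] := H k.
apply/rowP => k; rewrite derive_mx // mxE; have [_ ->] := H k.
rewrite !mxE -!big_split; apply: eq_bigr => i _ /=.
by rewrite -!big_split; apply: eq_bigr => l _ /=; rewrite ddE.
Qed.

Lemma smooth_Gam (O : set V) b Y Z : open O -> (forall y, O y -> U (b y)) ->
  smooth_on O b -> smooth_on O Y -> smooth_on O Z ->
  smooth_on O (fun y => Gam G (b y) (Y y) (Z y)).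
Proof.
move=> oO OU sb /(smooth_mxP oO) sY /(smooth_mxP oO) sZ.
apply/(smooth_mxP oO) => l k; under eq_fun do rewrite mxE.
apply: smooth_sum => // i; apply: smooth_sum => // j.
apply: smoothM => //; apply: smoothM => //.
exact: (@smooth_comp_scalar _ _ _ O U oO b sb OU
  (fun x => christoffel G x k i j) (smooth_christoffel k i j)).
Qed.

Lemma smooth_dot (O : set V) (A : V -> 'M[R]_n) Y Z : open O ->
  smooth_on O A -> smooth_on O Y -> smooth_on O Z ->
  smooth_on O (fun y => dot (A y) (Y y) (Z y)).
Proof.
move=> oO /(smooth_mxP oO) sA /(smooth_mxP oO) sY /(smooth_mxP oO) sZ.
under eq_fun do rewrite dotE.
apply: smooth_sum => // i; apply: smooth_sum => // j.
by apply: smoothM => //; apply: smoothM.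
Qed.

(* Covariant derivative of the field Z along the map b. *)
Definition nab b (v : V) Z : V -> E :=
  fun y => dd v Z y + Gam G (b y) (dd v b y) (Z y).

(** The curvature tensor in coordinates. It depends on the values of its arguments only, so it is
    tensorial from the start; [nab_curvature] and [curv_riem] relate it to covariant derivatives of
    fields. *)
Definition riem (x u v w : E) : E :=
  dGam x u v w - dGam x v u w
  + Gam G x u (Gam G x v w) - Gam G x v (Gam G x u w).

Variables (O : set V) (b : V -> E).
Hypotheses (oO : open O) (OU : forall y, O y -> U (b y)) (sb : smooth_on O b).

Lemma smooth_nab v Z : smooth_on O Z -> smooth_on O (nab b v Z).
Proof.
move=> sZ; apply: smoothD => //; first exact: smooth_dd.
by apply: smooth_Gam => //; exact: smooth_dd.
Qed.

Lemma smooth_metric_along : smooth_on O (G \o b).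
Proof. exact: (smooth_comp oO oU sb OU smG). Qed.

Lemma nab_metric v Y Z y : O y -> smooth_on O Y -> smooth_on O Z ->
  dd v (fun y => dot (G (b y)) (Y y) (Z y)) y =
  dot (G (b y)) (nab b v Y y) (Z y) + dot (G (b y)) (Y y) (nab b v Z y).
Proof.
move=> Oy sY sZ; have Uby := OU Oy.
rewrite (@dd_dot _ _ _ (G \o b)); [|exact: smooth_diff smooth_metric_along _ Oy
  |exact: smooth_diff sY _ Oy|exact: smooth_diff sZ _ Oy].
rewrite dd_comp; [|exact: smooth_diff sb _ Oy|exact: smooth_diff smG _ Uby].
by rewrite metric_compat // /nab dotDl dotDr /=; ring.
Qed.

Lemma nab_torsion_free v w y : O y ->
  nab b v (dd w b) y = nab b w (dd v b) y.
Proof.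
by move=> Oy; rewrite /nab (schwarz_dd v w oO Oy sb) (GamC _ _ _ sG).
Qed.

Lemma nab_nab v w Z y : O y -> smooth_on O Z ->
  nab b v (nab b w Z) y = dd v (dd w Z) y
   + (dGam (b y) (dd v b y) (dd w b y) (Z y)
      + Gam G (b y) (dd v (dd w b) y) (Z y) + Gam G (b y) (dd w b y) (dd v Z y))
   + Gam G (b y) (dd v b y) (dd w Z y + Gam G (b y) (dd w b y) (Z y)).
Proof.
move=> Oy sZ; rewrite /nab ddD.
- rewrite dd_Gam //; first exact: OU.
  + exact: smooth_diff sb _ Oy.
  + exact: smooth_diff (smooth_dd w sb) _ Oy.
  + exact: smooth_diff sZ _ Oy.
- exact: smooth_diff (smooth_dd w sZ) _ Oy.
- apply: smooth_diff Oy; apply: smooth_Gam => //; exact: smooth_dd.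
Qed.

Lemma nab_curvature v w Z y : O y -> smooth_on O Z ->
  nab b v (nab b w Z) y - nab b w (nab b v Z) y =
  riem (b y) (dd v b y) (dd w b y) (Z y).
Proof.
move=> Oy sZ; rewrite !nab_nab // (schwarz_dd w v oO Oy sZ).
rewrite (schwarz_dd w v oO Oy sb) !GamDr /riem.
(* [D] and [S] carry the second derivatives of [Z] and [b], and [T1], [T2] a first derivative of
   [Z]. They cancel, and what is left is the curvature. *)
have alg (D P Q S T1 T2 A B : E) : (D + (P + S + T1) + (T2 + A)) -
  (D + (Q + S + T2) + (T1 + B)) = P - Q + A - B.
  by apply/rowP => k; rewrite !mxE; ring.
exact: alg.
Qed.

End AlongMap.

End ConnectionAlong.

(** * Curvature *)

Section DirectionField.
Context {R : realType} {V : normedModType R} {k p q : nat}.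

Lemma dd_sum_scale (c : V -> 'rV[R]_k) (F : 'I_k -> V -> 'M[R]_(p, q)) x v :
  differentiable c x -> (forall a, differentiable (F a) x) ->
  dd v (fun y => \sum_a c y 0 a *: F a y) x =
  \sum_a (dd v c x 0 a *: F a x + c x 0 a *: dd v (F a) x).
Proof.
move=> dc dF; rewrite ddE.
have H i j : is_derive x v (fun y => (\sum_a c y 0 a *: F a y) i j)
    (\sum_a (dd v c x 0 a * F a x i j + c x 0 a * dd v (F a) x i j)).
  under eq_fun do (rewrite summxE; under eq_bigr do rewrite mxE).
  apply: is_derive_bigsum => a.
  have := is_deriveM (is_derive_coord v 0 a dc) (is_derive_coord v i j (dF a)).
  by move=> [? e]; split=> //; rewrite [LHS]e !ddE /GRing.scale /=; ring.
rewrite derive_mx; last by apply/derivable_mxP => i j; have [] := H i j.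
apply/matrixP => i j; rewrite mxE; have [_ ->] := H i j.
by rewrite summxE; apply: eq_bigr => a _; rewrite !mxE.
Qed.

End DirectionField.

Section DirectionRule.
Context {R : realType} {V : normedModType R} {k p q : nat}.

(* For Phi w z the derivative of a field at z in the direction w, this is the
   chain rule with a direction c that varies with the point. *)
Lemma dd_direction (O : set 'rV[R]_k)
    (Phi : 'rV[R]_k -> 'rV[R]_k -> 'M[R]_(p, q))
    (N : set V) (c h : V -> 'rV[R]_k) x v :
  open O -> (forall y, O y -> linear_map (Phi ^~ y)) ->
  (forall w, smooth_on O (Phi w)) ->
  open N -> N x -> (forall y, N y -> O (h y)) ->
  smooth_on N c -> smooth_on N h ->
  dd v (fun y => Phi (c y) (h y)) x =
  Phi (dd v c x) (h x) + dd (dd v h x) (Phi (c x)) (h x).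
Proof.
move=> oO lPhi sPhi oN Nx NO sc sh.
have dc := smooth_diff sc Nx; have dh := smooth_diff sh Nx.
have dP w : differentiable (Phi w) (h x).
  by apply: smooth_diff (sPhi w) _ (NO _ Nx).
rewrite (@near_eq_dd _ _ _ _
    (fun y => \sum_a c y 0 a *: (Phi (dx a) \o h) y)); last first.
  apply: near_open oN Nx _ => y Ny.
  exact: linear_map_sum (lPhi _ (NO _ Ny)).
rewrite dd_sum_scale //; last first.
  by move=> a; exact: (differentiable_comp dh (dP (dx a))).
rewrite big_split /=; congr (_ + _).
  by rewrite [RHS](linear_map_sum _ (lPhi _ (NO _ Nx))).
rewrite [in RHS](@near_eq_dd _ _ _ _
    (fun z => \sum_a (fun=> c x) z 0 a *: Phi (dx a) z)); last first.
  apply: near_open oO (NO _ Nx) _ => z Oz.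
  exact: linear_map_sum (lPhi _ Oz).
rewrite [RHS](@dd_sum_scale _ _ _ _ _ (fun=> c x) (fun a => Phi (dx a)));
  [|exact: differentiable_cst|by move=> a; exact: dP].
apply: eq_bigr => a _.
by rewrite dd_cst mxE scale0r add0r dd_comp.
Qed.

End DirectionRule.

(** Four Bianchi identities, one for each argument in last place. The skew symmetries reduce their
    terms to six values, and the claim is a linear combination of the four. *)
Lemma pair_symmetry (R : realDomainType) (T : Type)
    (Q : T -> T -> T -> T -> R) :
  (forall a b c d, Q a b c d = - Q b a c d) ->
  (forall a b c d, Q a b c d = - Q a b d c) ->
  (forall a b c d, Q a b c d + Q b c a d + Q c a b d = 0) ->
  forall a b c d, Q a b c d = Q c d a b.
Proof.
move=> Q12 Q34 B a b c d.
have := B a b c d; have := B b c d a; have := B c d a b; have := B d a b c.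
rewrite (Q34 b c d a) (Q34 c d b a) (Q12 d b c a).
rewrite (Q12 d a c b) (Q34 a d c b) (Q12 a c d b) (Q34 c a d b).
rewrite (Q12 d a b c) (Q34 a b d c) (Q34 b d a c).
move: (Q a b c d) (Q c d a b) (Q b c a d) (Q a d b c) (Q c a b d) (Q b d c a).
by move=> p q r r' s s'; lra.
Qed.

Section Riemann.
Context {R : realType} {n : nat}.
Local Notation E := 'rV[R]_n.
Variables (G : E -> 'M[R]_n) (U : set E).
Hypotheses (oU : open U) (sG : forall x, (G x)^T = G x).
Hypotheses (smG : smooth_on U G) (uG : forall x, U x -> G x \in unitmx).

Lemma nab_linear (k : nat) (b Z : 'rV[R]_k -> E) y :
  differentiable b y -> differentiable Z y ->
  linear_map (fun v => nab G b v Z y).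
Proof.
move=> db dZ c v w; rewrite /nab !dd_linear // GamDl GamZl scalerDr.
by rewrite addrACA.
Qed.

Lemma nab_id v (Z : E -> E) x : nab G id v Z x = dd v Z x + Gam G x v (Z x).
Proof. by rewrite /nab dd_id. Qed.

Lemma covE (Y Z : E -> E) x : cov G Y Z x = nab G id (Y x) Z x.
Proof. by rewrite nab_id ddE. Qed.

Lemma smooth_id (V : normedModType R) (O : set V) : smooth_on O (@id V).
Proof. by apply: (@smooth_linear _ _ _ _ (idfun : {linear V -> V})) => x. Qed.

Lemma riem_nab O v w (Z : E -> E) x : open O -> O `<=` U -> O x ->
  smooth_on O Z ->
  nab G id v (nab G id w Z) x - nab G id w (nab G id v Z) x =
  riem G x v w (Z x).
Proof.
move=> oO OU Ox sZ.
rewrite (nab_curvature oU smG uG oO OU (@smooth_id _ O) v w Ox sZ).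
by rewrite !dd_id.
Qed.

Lemma riem_skew x v w z : riem G x v w z = - riem G x w v z.
Proof.
by rewrite /riem; apply/rowP => i; rewrite ![in LHS]mxE ![in RHS]mxE; ring.
Qed.

Lemma dGamC x u v w : dGam G x u v w = dGam G x u w v.
Proof.
apply/rowP => k; rewrite !mxE exchange_big /=.
apply: eq_bigr => i _; apply: eq_bigr => j _; rewrite mulrAC.
rewrite (_ : (fun y => christoffel G y k i j) =
             fun y => christoffel G y k j i) //.
by apply/funext => y; exact: christoffel_torsion_free.
Qed.

Lemma riem_bianchi x u v w :
  riem G x u v w + riem G x v w u + riem G x w u v = 0.
Proof.
rewrite /riem (dGamC x u w v) (dGamC x v w u) (dGamC x w v u).
rewrite (GamC x w u sG) (GamC x w v sG) (GamC x v u sG).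
have alg (A B D P Q S : E) :
    (A - B + P - Q) + (B - D + Q - S) + (D - A + S - P) = 0.
  by apply/rowP => k; rewrite !mxE; ring.
exact: alg.
Qed.

(** Second derivatives of the function [g(w, z)], for constant [w] and [z], commute. Expanded by the
    metric connection, their mixed terms agree, and the rest is the claim. *)
Lemma riem_metric x u v w z : U x ->
  dot (G x) (riem G x u v w) z = - dot (G x) w (riem G x u v z).
Proof.
move=> Ux; have scst (a : E) : smooth_on U (fun=> a) by exact: smooth_cst.
have sid := @smooth_id _ U.
have IU y : U y -> U (@id E y) by [].
have sn c d : smooth_on U (nab G id c (fun=> d)).
  exact: (smooth_nab oU smG uG oU IU sid c (scst d)).
pose F y := dot (G y) w z.
have sF : smooth_on U F by exact: (smooth_dot oU smG (scst w) (scst z)).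
have F1 c y : U y -> dd c F y = dot (G y) (nab G id c (fun=> w) y) z
    + dot (G y) w (nab G id c (fun=> z) y).
  move=> Uy.
  exact: (nab_metric oU sG smG uG oU IU sid c Uy (scst w) (scst z)).
have F2 c d : dd c (dd d F) x =
  dot (G x) (nab G id c (nab G id d (fun=> w)) x) z
  + dot (G x) (nab G id d (fun=> w) x) (nab G id c (fun=> z) x)
  + (dot (G x) (nab G id c (fun=> w) x) (nab G id d (fun=> z) x)
     + dot (G x) w (nab G id c (nab G id d (fun=> z)) x)).
  rewrite (near_eq_dd _ (near_open oU Ux (F1 d))) ddD.
  - rewrite (nab_metric oU sG smG uG oU IU sid c Ux (sn d w) (scst z)).
    by rewrite (nab_metric oU sG smG uG oU IU sid c Ux (scst w) (sn d z)).
  - exact: smooth_diff (smooth_dot oU smG (sn d w) (scst z)) _ Ux.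
  - exact: smooth_diff (smooth_dot oU smG (scst w) (sn d z)) _ Ux.
have := schwarz_dd_scalar u v oU Ux sF.
rewrite (F2 u v) (F2 v u).
rewrite -(riem_nab u v oU (@subset_refl _ U) Ux (scst w)).
rewrite -(riem_nab u v oU (@subset_refl _ U) Ux (scst z)) dotBl dotBr.
have alg (a b c d a' d' : R) : a + b + (c + d) = a' + c + (b + d') ->
  a - a' = - (d - d') by lra.
exact: alg.
Qed.

Lemma riem_pair x u v w z : U x ->
  dot (G x) (riem G x u v w) z = dot (G x) (riem G x w z u) v.
Proof.
move=> Ux; pose Q a b c d := dot (G x) (riem G x a b c) d.
have Q12 a b c d : Q a b c d = - Q b a c d by rewrite /Q riem_skew dotNl.
have Q34 a b c d : Q a b c d = - Q a b d c.
  by rewrite /Q riem_metric // (dotC _ _ (sG x)).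
have B a b c d : Q a b c d + Q b c a d + Q c a b d = 0.
  by rewrite /Q -!dotDl riem_bianchi dot0l.
exact: (pair_symmetry Q12 Q34 B).
Qed.

End Riemann.

(** * The second fundamental form of a map into the unit tangent bundle *)

Lemma sffE (R : realType) (n k : nat) (G : 'rV[R]_n -> 'M[R]_n)
    (H : 'rV[R]_k -> 'M[R]_k) h x v w :
  second_fundamental_form G H h x v w =
  dd v (dd w h) x + Gam H (h x) (dd v h x) (dd w h x) - dd (Gam G x v w) h x.
Proof. by rewrite !ddE. Qed.

Section SasakiAlong.
Context {R : realType} {n k : nat}.
Local Notation E := 'rV[R]_n.
Local Notation F := 'rV[R]_k.
Variables (G : E -> 'M[R]_n) (U : set E).
Hypotheses (oU : open U) (sG : forall x, (G x)^T = G x).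
Hypotheses (smG : smooth_on U G) (uG : forall x, U x -> G x \in unitmx).
Variables (W : set F) (b u : F -> E).
Hypotheses (oW : open W) (WU : forall y, W y -> U (b y)).
Hypotheses (sb : smooth_on W b) (su : smooth_on W u).

(* H is the pull-back of the Sasaki metric under the map y |-> (b y, u y). *)
Variable H : F -> 'M[R]_k.
Hypotheses (sH : forall y, (H y)^T = H y) (smH : smooth_on W H).
Hypothesis uH : forall y, W y -> H y \in unitmx.
Hypothesis HE : forall y v w, W y -> dot (H y) v w =
  dot (G (b y)) (dd v b y) (dd w b y) +
  dot (G (b y)) (nab G b v u y) (nab G b w u y).

(** Differentiating [HE] gives base terms [T1] and fibre terms [T2]. Absence of torsion makes [T1]
    symmetric in its first two arguments, so the base terms collapse to one, as for any map. [T2] is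
    symmetric only up to curvature acting on [u]; these defects are the two [riem] terms. *)
Lemma koszul_sasaki y v w a : W y -> dot (H y) (Gam H y v w) a =
  dot (G (b y)) (nab G b v (dd w b) y) (dd a b y) +
  2^-1 * (dot (G (b y)) (nab G b v (nab G b w u) y + nab G b w (nab G b v u) y)
            (nab G b a u y)
    + (dot (G (b y)) (nab G b w u y) (riem G (b y) (dd v b y) (dd a b y) (u y))
     + dot (G (b y)) (nab G b v u y)
         (riem G (b y) (dd w b y) (dd a b y) (u y)))).
Proof.
move=> Wy; rewrite (koszul sH smH uH v w a Wy).
pose T1 p q r := dot (G (b y)) (nab G b p (dd q b) y) (dd r b y).
pose T2 p q r := dot (G (b y)) (nab G b p (nab G b q u) y) (nab G b r u y).
have sdb p : smooth_on W (dd p b) by exact: smooth_dd.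
have snu p : smooth_on W (nab G b p u).
  exact: (smooth_nab oU smG uG oW WU sb p su).
have sGb : smooth_on W (G \o b) by exact: (smooth_metric_along oU smG oW WU sb).
(* For constant [q] and [r] the derivative of the matrix [H] is that of the function
   [dot (H y) q r], to which [HE] applies near [y]. *)
have S p q r : dot (dd p H y) q r = T1 p q r + T1 p r q + (T2 p q r + T2 p r q).
  transitivity (dd p (fun y => dot (H y) q r) y).
    rewrite dd_dot; [|exact: smooth_diff smH _ Wy
                     |exact: differentiable_cst|exact: differentiable_cst].
    by rewrite !dd_cst dot0l dot0r !addr0.
  rewrite (near_eq_dd _ (near_open oW Wy (fun y Wy => HE q r Wy))) ddD.
  - rewrite (nab_metric oU sG smG uG oW WU sb p Wy (sdb q) (sdb r)).
    rewrite (nab_metric oU sG smG uG oW WU sb p Wy (snu q) (snu r)).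
    rewrite /T1 /T2 (dotC (dd q b y) _ (sG _)).
    by rewrite (dotC (nab G b q u y) _ (sG _)).
  - exact: smooth_diff (smooth_dot oW sGb (sdb q) (sdb r)) _ Wy.
  - exact: smooth_diff (smooth_dot oW sGb (snu q) (snu r)) _ Wy.
have T1C p q r : T1 p q r = T1 q p r.
  by rewrite /T1 (nab_torsion_free sG oW sb p q Wy).
have T2C p q r : T2 p q r - T2 q p r =
    dot (G (b y)) (nab G b r u y) (riem G (b y) (dd p b y) (dd q b y) (u y)).
  rewrite /T2 -dotBl (nab_curvature oU smG uG oW WU sb p q Wy su).
  by rewrite (dotC _ _ (sG _)).
rewrite !S -!T2C dotDl -/(T1 v w a) -/(T2 v w a) -/(T2 w v a).
rewrite (T1C w v a) (T1C a v w) (T1C a w v).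
move: (T1 v w a) (T1 v a w) (T1 w a v) (T2 v w a) (T2 v a w) (T2 w v a)
  (T2 w a v) (T2 a v w) (T2 a w v).
by move=> *; field.
Qed.

Variables (N : set E) (h : E -> F) (X : E -> E).
Hypotheses (oN : open N) (NU : N `<=` U) (NW : forall x, N x -> W (h x)).
Hypotheses (sh : smooth_on N h) (sX : smooth_on N X).
Hypotheses (bh : forall x, N x -> b (h x) = x).
Hypotheses (uh : forall x, N x -> u (h x) = X x).

(** The second covariant derivative of [Z], extending [v] and [w] as constant fields. Its skew part
    is the curvature acting on [Z], and its trace is minus the rough Laplacian. *)
Definition hess (Z : E -> E) (x v w : E) : E :=
  nab G id v (nab G id w Z) x - nab G id (Gam G x v w) Z x.

Lemma dd_base v x : N x -> dd (dd v h x) b (h x) = v.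
Proof.
move=> Nx; rewrite -dd_comp; [|exact: smooth_diff sh _ Nx
  |exact: smooth_diff sb _ (NW Nx)].
by rewrite (near_eq_dd _ (near_open oN Nx bh)) dd_id.
Qed.

Lemma nab_fiber v x : N x -> nab G b (dd v h x) u (h x) = nab G id v X x.
Proof.
move=> Nx; rewrite nab_id /nab -dd_comp; [|exact: smooth_diff sh _ Nx
  |exact: smooth_diff su _ (NW Nx)].
rewrite (near_eq_dd _ (near_open oN Nx uh)).
by rewrite (dd_base v Nx) (bh Nx) (uh Nx).
Qed.

(** This differentiates [nab_fiber] once more. Its direction [dd w h y] moves with [y], whence the
    term with the second derivative of [h]. *)
Lemma nab_nab_fiber v w x : N x -> nab G id v (nab G id w X) x =
  nab G b (dd v (dd w h) x) u (h x)
  + nab G b (dd v h x) (nab G b (dd w h x) u) (h x).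
Proof.
move=> Nx; rewrite nab_id.
have near_w y : N y -> nab G id w X y = nab G b (dd w h y) u (h y).
  by move=> Ny; rewrite nab_fiber.
rewrite (near_eq_dd _ (near_open oN Nx near_w)).
rewrite (@dd_direction _ _ _ _ _ W (fun c y => nab G b c u y) N (dd w h) h) //.
- rewrite -addrA; congr (_ + _).
  by rewrite [RHS]/nab (dd_base v Nx) (bh Nx) near_w.
- move=> y Wy; apply: nab_linear; [exact: smooth_diff sb _ Wy
  |exact: smooth_diff su _ Wy].
- by move=> c; exact: (smooth_nab oU smG uG oW WU sb c su).
- exact: smooth_dd.
Qed.

(** The second derivative of [b (h y) = y] vanishes, and the remaining Christoffel term comes from
    [nab] on the right. In [sff_dot] this cancels all base terms, so that only curvature is paired
    with [dd a b]. *)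
Lemma Gam_base v w x : N x -> Gam G x v w =
  dd (dd v (dd w h) x) b (h x) + nab G b (dd v h x) (dd (dd w h x) b) (h x).
Proof.
move=> Nx; rewrite /nab (dd_base v Nx) (dd_base w Nx) (bh Nx) addrA.
rewrite -(@dd_direction _ _ _ _ _ W (fun c y => dd c b y) N (dd w h) h) //.
- rewrite (near_eq_dd _ (near_open oN Nx (fun y Ny => dd_base w Ny))).
  by rewrite dd_cst add0r.
- by move=> y Wy c v1 v2; rewrite dd_linear //; exact: smooth_diff sb _ Wy.
- by move=> c; exact: smooth_dd.
- exact: smooth_dd.
Qed.

Lemma sff_dot x v w a : N x ->
  dot (H (h x)) (second_fundamental_form G H h x v w) a =
  2^-1 * (dot (G x) (hess X x v w + hess X x w v) (nab G b a u (h x))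
    + (dot (G x) (nab G id w X x) (riem G x v (dd a b (h x)) (X x))
     + dot (G x) (nab G id v X x) (riem G x w (dd a b (h x)) (X x)))).
Proof.
move=> Nx; have Wh := NW Nx.
rewrite sffE.
have hE p q : hess X x p q = nab G b (dd p (dd q h) x) u (h x)
    + nab G b (dd p h x) (nab G b (dd q h x) u) (h x)
    - nab G id (Gam G x p q) X x.
  by rewrite /hess (nab_nab_fiber p q Nx).
rewrite dotBl (dotDl _ (dd v (dd w h) x)) (koszul_sasaki _ _ _ Wh) !(HE _ _ Wh).
rewrite (bh Nx) (uh Nx) !(dd_base _ Nx) !(nab_fiber _ Nx).
rewrite [X in X - _ = _]addrA.
have -> : dot (G x) (Gam G x v w) (dd a b (h x)) =
    dot (G x) (dd (dd v (dd w h) x) b (h x)) (dd a b (h x)) +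
    dot (G x) (nab G b (dd v h x) (dd (dd w h x) b) (h x)) (dd a b (h x)).
  by rewrite -dotDl -Gam_base.
rewrite !hE (schwarz_dd w v oN Nx sh) (GamC _ w v sG).
move: (nab G b (dd v (dd w h) x) u (h x)) (nab G id (Gam G x v w) X x)
  (nab G b (dd v h x) (nab G b (dd w h x) u) (h x))
  (nab G b (dd w h x) (nab G b (dd v h x) u) (h x))
  (nab G b (dd v h x) (dd (dd w h x) b) (h x))
  (nab G id v X x) (nab G id w X x) (nab G b a u (h x)) => A B C D P Q S T.
rewrite !dotDl !dotNl.
by field.
Qed.
End SasakiAlong.

(** * Traces in an orthonormal frame *)

Section FrameTrace.
Context {R : realType} {n : nat} {W : lmodType R}.

(** If [P] has the vectors of the frame as rows, orthonormality reads [P A P^T = 1], and for square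
    matrices this gives [P^T P A = 1]. *)
Lemma frame_left_inverse (A : 'M[R]_n) (e : 'I_n -> 'rV[R]_n) :
  (forall i j, dot A (e i) (e j) = (i == j)%:R) ->
  (\matrix_(i, j) \sum_a e a 0 i * e a 0 j) *m A = 1%:M.
Proof.
move=> oe; pose P := \matrix_(a, i) e a 0 i : 'M[R]_n.
have PAP : P *m A *m P^T = 1%:M.
  apply/matrixP => i j; rewrite [RHS]mxE -oe dotE mxE exchange_big /=.
  apply: eq_bigr => l _; rewrite !mxE mulr_suml; apply: eq_bigr => m _.
  by rewrite !mxE.
rewrite (_ : \matrix_(i, j) _ = P^T *m P).
  by rewrite -mulmxA; exact: mulmx1C.
by apply/matrixP => i j; rewrite !mxE; apply: eq_bigr => a _; rewrite !mxE.
Qed.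

Lemma frame_unitmx (A : 'M[R]_n) (e : 'I_n -> 'rV[R]_n) :
  (forall i j, dot A (e i) (e j) = (i == j)%:R) -> A \in unitmx.
Proof. by move=> /frame_left_inverse /mulmx1_unit[]. Qed.

Lemma invmx_frame (A : 'M[R]_n) (e : 'I_n -> 'rV[R]_n) :
  (forall i j, dot A (e i) (e j) = (i == j)%:R) ->
  invmx A = \matrix_(i, j) \sum_a e a 0 i * e a 0 j.
Proof.
move=> oe; have uA := frame_unitmx oe.
by rewrite -[RHS]mulmx1 -(mulmxV uA) mulmxA (frame_left_inverse oe) mul1mx.
Qed.

(** Links the trace in [tension], taken with the inverse metric matrix, to the sums over a frame in
    [tr_curv] and [rough_laplacian]. *)
Lemma trace_frame (A : 'M[R]_n) (e : 'I_n -> 'rV[R]_n)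
    (B : 'rV[R]_n -> 'rV[R]_n -> W) :
  (forall i j, dot A (e i) (e j) = (i == j)%:R) ->
  (forall w, linear_map (B ^~ w)) -> (forall v, linear_map (B v)) ->
  \sum_i \sum_j invmx A i j *: B (dx i) (dx j) = \sum_a B (e a) (e a).
Proof.
move=> oe lB1 lB2; rewrite (invmx_frame oe).
under [RHS]eq_bigr => a _ do rewrite (linear_map_sum (e a) (lB1 (e a))).
rewrite [RHS]exchange_big /=; apply: eq_bigr => i _.
under [RHS]eq_bigr => a _ do
  rewrite (linear_map_sum (e a) (lB2 (dx i))) scaler_sumr.
rewrite [RHS]exchange_big /=; apply: eq_bigr => j _.
by rewrite mxE scaler_suml; apply: eq_bigr => a _; rewrite scalerA.
Qed.

End FrameTrace.

Section LinearMapTheory.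
Context {R : realType} {n : nat} {W : lmodType R}.

Lemma linear_mapD (f g : 'rV[R]_n -> W) : linear_map f -> linear_map g ->
  linear_map (fun v => f v + g v).
Proof. by move=> lf lg c v w; rewrite lf lg scalerDr addrACA. Qed.

Lemma linear_mapN (f : 'rV[R]_n -> W) : linear_map f ->
  linear_map (fun v => - f v).
Proof. by move=> lf c v w; rewrite lf opprD scalerN. Qed.

Lemma linear_mapZ (a : R) (f : 'rV[R]_n -> W) : linear_map f ->
  linear_map (fun v => a *: f v).
Proof. by move=> lf c v w; rewrite lf scalerDr !scalerA mulrC. Qed.

End LinearMapTheory.

Lemma linear_map_comp (R : realType) (n m : nat) (W : lmodType R)
    (f : 'rV[R]_m -> W) (g : 'rV[R]_n -> 'rV[R]_m) :
  linear_map f -> linear_map g -> linear_map (fun v => f (g v)).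
Proof. by move=> lf lg c v w; rewrite lg lf. Qed.

Lemma linear_map_dotl (R : realType) (n : nat) (A : 'M[R]_n) w :
  linear_map (fun v => dot A v w).
Proof. by move=> c v1 v2; rewrite dotDl dotZl. Qed.

Lemma linear_map_dotr (R : realType) (n : nat) (A : 'M[R]_n) w :
  linear_map (fun v => dot A w v).
Proof. by move=> c v1 v2; rewrite dotDr dotZr. Qed.

Lemma linear_map_Gaml (R : realType) (n : nat) (G : 'rV[R]_n -> 'M[R]_n) x w :
  linear_map (fun v => Gam G x v w).
Proof. by move=> c v1 v2; rewrite GamDl GamZl. Qed.

Lemma linear_map_Gamr (R : realType) (n : nat) (G : 'rV[R]_n -> 'M[R]_n) x w :
  linear_map (fun v => Gam G x w v).
Proof. by move=> c v1 v2; rewrite GamDr GamZr. Qed.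

Section LocalOperators.
Context {R : realType} {n : nat}.
Local Notation E := 'rV[R]_n.
Variables (G : E -> 'M[R]_n) (U : set E).
Hypotheses (oU : open U) (sG : forall x, (G x)^T = G x).
Hypotheses (smG : smooth_on U G) (uG : forall x, U x -> G x \in unitmx).

Lemma linear_map_dGam1 x v w : U x -> linear_map (fun u => dGam G x u v w).
Proof.
move=> Ux c u1 u2; apply/rowP => k; rewrite !mxE mulr_sumr -big_split.
apply: eq_bigr => i _ /=; rewrite mulr_sumr -big_split;
  apply: eq_bigr => j _ /=.
rewrite dd_linear; first by rewrite /GRing.scale /=; ring.
exact: smooth_diff (smooth_christoffel oU smG uG k i j) _ Ux.
Qed.

Lemma linear_map_dGam2 x u w : linear_map (fun v => dGam G x u v w).
Proof.
move=> c v1 v2; apply/rowP => k; rewrite !mxE mulr_sumr -big_split.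
apply: eq_bigr => i _ /=; rewrite mulr_sumr -big_split;
  apply: eq_bigr => j _ /=.
by rewrite !mxE; ring.
Qed.

Lemma linear_map_riem1 x v w : U x -> linear_map (fun u => riem G x u v w).
Proof.
move=> Ux; rewrite /riem; apply: linear_mapD.
  apply: linear_mapD; last exact: linear_map_Gaml.
  by apply: linear_mapD; [exact: linear_map_dGam1
    |apply: linear_mapN; exact: linear_map_dGam2].
apply: linear_mapN; apply: (linear_map_comp (@linear_map_Gamr _ _ G x v)).
exact: linear_map_Gaml.
Qed.

Lemma linear_map_riem2 x u w : U x -> linear_map (fun v => riem G x u v w).
Proof.
move=> Ux; rewrite (_ : (fun v => _) = fun v => - riem G x v u w).
  by apply: linear_mapN; exact: linear_map_riem1.
by apply/funext => v; rewrite riem_skew.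
Qed.

Variables (O : set E).
Hypotheses (oO : open O) (OU : O `<=` U).
Implicit Types Y Z X : E -> E.

Lemma smooth_nab_id v Z : smooth_on O Z -> smooth_on O (nab G id v Z).
Proof. exact: (smooth_nab oU smG uG oO OU (@smooth_id _ _ O) v). Qed.

Lemma linear_map_nab_id Z x : O x -> smooth_on O Z ->
  linear_map (fun v => nab G id v Z x).
Proof.
move=> Ox sZ; apply: nab_linear.
  exact: smooth_diff (@smooth_id _ _ O) _ Ox.
exact: smooth_diff sZ _ Ox.
Qed.

Lemma smooth_cov Y Z : smooth_on O Y -> smooth_on O Z ->
  smooth_on O (cov G Y Z).
Proof.
move=> sY sZ.
apply: (@eq_smooth _ _ _ oO _ (fun x => \sum_j Y x 0 j *: nab G id (dx j) Z x)).
  move=> x Ox; rewrite covE.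
  by rewrite [RHS](linear_map_sum _ (linear_map_nab_id Ox sZ)).
apply: smooth_sum => // j; apply: smooth_scale => //; last exact: smooth_nab_id.
by have /(smooth_mxP oO) := sY; exact.
Qed.

Lemma cov_cov v Z X x : O x -> smooth_on O Z -> smooth_on O X ->
  nab G id v (cov G Z X) x =
  nab G id v (nab G id (Z x) X) x + nab G id (dd v Z x) X x.
Proof.
move=> Ox sZ sX; rewrite nab_id.
rewrite (_ : cov G Z X = fun y => nab G id (Z y) X (id y)); last first.
  by apply/funext => y; rewrite covE.
rewrite (@dd_direction _ _ _ _ _ O (fun c y => nab G id c X y) O Z id) //.
- by rewrite dd_id (nab_id _ v (nab G id (Z x) X)) -addrA addrC.
- by move=> y Oy; exact: linear_map_nab_id.
- by move=> c; exact: smooth_nab_id.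
- exact: smooth_id.
Qed.

(** The fields in [tr_curv] are not constant. The derivatives of [Y] and [Z] that arise from the
    moving directions cancel against the bracket; in [hess_cov] the analogous term cancels against
    the derivative along [cov G Y Y]. *)
Lemma curv_riem Y Z X x : O x ->
  smooth_on O Y -> smooth_on O Z -> smooth_on O X ->
  curv G Y Z X x = riem G x (Y x) (Z x) (X x).
Proof.
move=> Ox sY sZ sX; rewrite /curv !covE !cov_cov //.
rewrite -(riem_nab oU smG uG (Y x) (Z x) oO OU Ox sX) .
have -> : bracket Y Z x = dd (Y x) Z x - dd (Z x) Y x by rewrite !ddE.
have lX := linear_map_nab_id Ox sX.
have -> : nab G id (dd (Y x) Z x - dd (Z x) Y x) X x =
    nab G id (dd (Y x) Z x) X x - nab G id (dd (Z x) Y x) X x.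
  by rewrite addrC -scaleN1r lX scaleN1r addrC.
have alg (A B C D : E) : A + B - (C + D) - (B - D) = A - C.
  by apply/rowP => k; rewrite !mxE; ring.
exact: alg.
Qed.

Lemma hess_cov Y X x : O x -> smooth_on O Y -> smooth_on O X ->
  cov G Y (cov G Y X) x - cov G (cov G Y Y) X x = hess G X x (Y x) (Y x).
Proof.
move=> Ox sY sX; rewrite !covE cov_cov // /hess (nab_id _ _ Y).
have lX := linear_map_nab_id Ox sX.
rewrite -[dd (Y x) Y x]scale1r lX !scale1r.
have alg (A B C : E) : A + B - (B + C) = A - C.
  by apply/rowP => k; rewrite !mxE; ring.
exact: alg.
Qed.

Lemma linear_map_hess1 X x w : O x -> smooth_on O X ->
  linear_map (fun v => hess G X x v w).
Proof.
move=> Ox sX; apply: linear_mapD.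
  by apply: linear_map_nab_id => //; exact: smooth_nab_id.
apply: linear_mapN; apply: (linear_map_comp (linear_map_nab_id Ox sX)).
exact: linear_map_Gaml.
Qed.

(** The inner argument sits under a derivative; the Ricci identity exchanges it with the outer one,
    up to a curvature term that is linear. *)
Lemma linear_map_hess2 X x v : O x -> smooth_on O X ->
  linear_map (hess G X x v).
Proof.
move=> Ox sX.
rewrite (_ : hess G X x v = fun w => hess G X x w v + riem G x v w (X x)).
  apply: linear_mapD; first exact: linear_map_hess1.
  by apply: linear_map_riem2; exact: OU.
apply/funext => w; rewrite -(riem_nab oU smG uG v w oO OU Ox sX) /hess.
rewrite (GamC _ w v sG).
have alg (A B C : E) : A - C = B - C + (A - B).
  by apply/rowP => k; rewrite !mxE; ring.
exact: alg.
Qed.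

Section UnitField.
Variable X : E -> E.
Hypothesis sX : smooth_on O X.
Hypothesis X1 : forall x, O x -> dot (G x) (X x) (X x) = 1.

Lemma nab_unit x v : O x -> dot (G x) (nab G id v X x) (X x) = 0.
Proof.
move=> Ox.
have := nab_metric oU sG smG uG oO OU (@smooth_id _ _ O) v Ox sX sX.
rewrite (near_eq_dd _ (near_open oO Ox X1)) dd_cst /= (dotC (X x) _ (sG x)).
by move=> /eqP; rewrite eq_sym -mulr2n mulrn_eq0 /= => /eqP.
Qed.

(** The identity [nab_unit] differentiated once more along [v]. This is where the term [|nabla X|^2]
    of the theorem comes from. *)
Lemma hess_unit x v : O x ->
  dot (G x) (hess G X x v v) (X x) =
  - dot (G x) (nab G id v X x) (nab G id v X x).
Proof.
move=> Ox; rewrite /hess dotBl nab_unit // subr0.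
have sid := @smooth_id _ _ O.
have := nab_metric oU sG smG uG oO OU sid v Ox (smooth_nab_id v sX) sX.
rewrite (near_eq_dd _ (near_open oO Ox (fun y Oy => nab_unit v Oy))) dd_cst /=.
by move=> /eqP; rewrite eq_sym addr_eq0 => /eqP.
Qed.

End UnitField.

End LocalOperators.

(** * The tension field of a unit vector field *)

Section BlockDerivative.
Context {R : realType} {V : normedModType R} {m p q : nat}.

Lemma dd_coord r c (f : V -> 'M[R]_(r, c)) x v i j : differentiable f x ->
  (dd v f x) i j = dd v (fun y => f y i j) x.
Proof. by rewrite !ddE; exact: derivative_coord. Qed.

Lemma differentiable_row_mx (f : V -> 'M[R]_(m, p)) (g : V -> 'M[R]_(m, q)) x :
  differentiable f x -> differentiable g x ->
  differentiable (fun y => row_mx (f y) (g y)) x.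
Proof.
move=> /differentiable_mxP df /differentiable_mxP dg.
apply/differentiable_mxP => i j; case: (split_ordP j) => l ->.
  by under eq_fun do rewrite row_mxEl; exact: df.
by under eq_fun do rewrite row_mxEr; exact: dg.
Qed.

Lemma dd_row_mx (f : V -> 'M[R]_(m, p)) (g : V -> 'M[R]_(m, q)) x v :
  differentiable f x -> differentiable g x ->
  dd v (fun y => row_mx (f y) (g y)) x = row_mx (dd v f x) (dd v g x).
Proof.
move=> df dg; apply/matrixP => i j.
rewrite dd_coord; last exact: differentiable_row_mx.
case: (split_ordP j) => l ->.
  by under eq_fun do rewrite row_mxEl; rewrite row_mxEl dd_coord.
by under eq_fun do rewrite row_mxEr; rewrite row_mxEr dd_coord.
Qed.

End BlockDerivative.

Section LocalEquivalence.
Context {R : realType} {n k : nat}.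
Local Notation E := 'rV[R]_n.
Local Notation F := 'rV[R]_k.
Variables (G : E -> 'M[R]_n) (U : set E).
Hypotheses (oU : open U) (sG : forall x, (G x)^T = G x).
Hypotheses (smG : smooth_on U G) (uG : forall x, U x -> G x \in unitmx).
Variable X : E -> E.
Hypothesis sX : smooth_on U X.
Hypothesis X1 : forall x, U x -> dot (G x) (X x) (X x) = 1.

Section Frame.
Variables (O : set E) (e : 'I_n -> E -> E).
Hypothesis oe : orthonormal_frame G U O e.

Let oO : open O. Proof. by case: oe. Qed.
Let OU : O `<=` U. Proof. by case: oe. Qed.
Let se i : smooth_on O (e i). Proof. by case: oe. Qed.
Let sXO : smooth_on O X. Proof. exact: smooth_sub OU sX. Qed.

Lemma tr_curv_riem x : O x -> tr_curv G e X x =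
  \sum_i riem G x (nab G id (e i x) X x) (X x) (e i x).
Proof.
move=> Ox; apply: eq_bigr => i _.
have sc := smooth_cov oU smG uG oO OU (se i) sXO.
rewrite (curv_riem oU smG uG oO OU Ox sc sXO (se i)).
by rewrite covE.
Qed.

Lemma rough_laplacian_hess x : O x ->
  rough_laplacian G e X x = - \sum_i hess G X x (e i x) (e i x).
Proof.
move=> Ox; congr (- _); apply: eq_bigr => i _.
exact: (hess_cov oU smG uG oO OU Ox (se i) sXO).
Qed.

Lemma normsq_cov_nab x : normsq_cov G e X x =
  \sum_i dot (G x) (nab G id (e i x) X x) (nab G id (e i x) X x).
Proof. by apply: eq_bigr => i _; rewrite covE. Qed.

(** True for every unit field, so the second equation of the theorem constrains only the part of the
    rough Laplacian orthogonal to [X]. *)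
Lemma rough_laplacian_unit x : O x ->
  dot (G x) (rough_laplacian G e X x) (X x) = normsq_cov G e X x.
Proof.
move=> Ox; rewrite rough_laplacian_hess // normsq_cov_nab dotNl dot_suml -sumrN.
apply: eq_bigr => i _.
have X1O y (Oy : O y) := X1 (OU Oy).
by rewrite (hess_unit oU sG smG uG oO OU sXO X1O _ Ox) opprK.
Qed.

(* The curvature terms of the second fundamental form are turned into
   tr_curv by the pair symmetry of the curvature tensor. *)
Lemma sff_trace x al be : O x ->
  \sum_i \sum_j invmx (G x) i j *:
    (2^-1 * (dot (G x) (hess G X x (dx i) (dx j) + hess G X x (dx j) (dx i)) be
      + (dot (G x) (nab G id (dx j) X x) (riem G x (dx i) al (X x))
       + dot (G x) (nab G id (dx i) X x) (riem G x (dx j) al (X x))))) =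
  - dot (G x) (rough_laplacian G e X x) be - dot (G x) (tr_curv G e X x) al.
Proof.
move=> Ox; have Ux := OU Ox.
pose B v w := 2^-1 * (dot (G x) (hess G X x v w + hess G X x w v) be
      + (dot (G x) (nab G id w X x) (riem G x v al (X x))
       + dot (G x) (nab G id v X x) (riem G x w al (X x)))).
have lh1 w := linear_map_hess1 oU smG uG oO OU w Ox sXO.
have lh2 v := linear_map_hess2 oU sG smG uG oO OU v Ox sXO.
have lX := linear_map_nab_id G Ox sXO.
have lr := linear_map_riem1 oU smG uG al (X x) Ux.
have BC v w : B v w = B w v.
  by rewrite /B [hess G X x v w + _]addrC [X in _ * (_ + X)]addrC.
have lB1 w : linear_map (B ^~ w).
  apply: (@linear_mapZ R n R^o); apply: (@linear_mapD R n R^o).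
    apply: (linear_map_comp (@linear_map_dotl R n (G x) be)).
    by apply: linear_mapD; [exact: lh1|exact: lh2].
  apply: (@linear_mapD R n R^o).
    exact: (linear_map_comp (@linear_map_dotr R n (G x) _) lr).
  exact: (linear_map_comp (@linear_map_dotl R n (G x) _) lX).
have lB2 v : linear_map (B v).
  by move=> c v1 v2; rewrite !(BC v); exact: lB1.
have [_ _ _ /(_ x Ox) oex] := oe.
rewrite -/(B _ _).
rewrite (@trace_frame R n R^o (G x) (fun i => e i x) B oex lB1 lB2).
rewrite rough_laplacian_hess // tr_curv_riem // dotNl opprK !dot_suml.
rewrite -sumrN -big_split /=; apply: eq_bigr => i _.
(* On the diagonal the two Hessian terms coincide and so do the two curvature terms, which absorbs
   the factor [2^-1]. *)
rewrite /B dotDl [in RHS]riem_skew dotNl opprK.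
rewrite (riem_pair oU sG smG uG (X x) _ _ _ Ux).
rewrite (dotC (nab G id (e i x) X x) _ (sG x)).
by field.
Qed.

End Frame.

Variables (W : set F) (iota : F -> 'rV[R]_(n + n)).
Local Notation b := (fun y => base (iota y)).
Local Notation u := (fun y => fiber (iota y)).
Hypotheses (oW : open W) (WU : forall y, W y -> U (b y)).
Hypothesis si : smooth_on W iota.
Variable H : F -> 'M[R]_k.
Hypotheses (sH : forall y, (H y)^T = H y) (smH : smooth_on W H).
Hypothesis uH : forall y, W y -> H y \in unitmx.
Hypothesis HE : forall y v w, W y -> dot (H y) v w =
  dot (G (b y)) (dd v b y) (dd w b y) +
  dot (G (b y)) (nab G b v u y) (nab G b w u y).
Variables (N : set E) (h : E -> F).
Hypotheses (oN : open N) (NU : N `<=` U) (NW : forall x, N x -> W (h x)).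
Hypothesis sh : smooth_on N h.
Hypothesis ih : forall x, N x -> iota (h x) = row_mx x (X x).
Variable x : E.
Hypotheses (Nx : N x) (posG : forall v, v != 0 -> 0 < dot (G x) v v).
Hypothesis tangent : forall a, dot (G x) (nab G b a u (h x)) (X x) = 0.
Hypothesis tangent_onto : forall al be, dot (G x) be (X x) = 0 ->
  exists a, dd a b (h x) = al /\ nab G b a u (h x) = be.

Let sb : smooth_on W b. Proof. exact: smooth_lsubmx. Qed.
Let su : smooth_on W u. Proof. exact: smooth_rsubmx. Qed.
Let bh y : N y -> b (h y) = y.
Proof. by move=> Ny; rewrite /= (ih Ny) /base row_mxKl. Qed.
Let uh y : N y -> u (h y) = X y.
Proof. by move=> Ny; rewrite /= (ih Ny) /fiber row_mxKr. Qed.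

Lemma dot_inj v w : (forall al, dot (G x) v al = dot (G x) w al) -> v = w.
Proof.
move=> vw; apply/eqP; rewrite -subr_eq0; apply: contraT => /posG.
by rewrite dotBl vw subrr ltxx.
Qed.

Variables (O : set E) (e : 'I_n -> E -> E).
Hypotheses (oe : orthonormal_frame G U O e) (Ox : O x).

Lemma tension_dot a :
  dot (G x) (dd (tension G H h x) b (h x)) (dd a b (h x)) +
  dot (G x) (nab G b (tension G H h x) u (h x)) (nab G b a u (h x)) =
  - dot (G x) (rough_laplacian G e X x) (nab G b a u (h x))
  - dot (G x) (tr_curv G e X x) (dd a b (h x)).
Proof.
transitivity (dot (H (h x)) (tension G H h x) a).
  by rewrite (HE _ _ (NW Nx)) (bh Nx).
rewrite -(sff_trace oe _ _ Ox).
rewrite /tension dot_suml; apply: eq_bigr => i _.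
rewrite dot_suml; apply: eq_bigr => j _; rewrite dotZl.
congr (_ * _).
exact: (sff_dot oU sG smG uG oW WU sb su sH smH uH HE oN NW sh bh uh).
Qed.

Lemma tension_horizontal : dd (tension G H h x) b (h x) = - tr_curv G e X x.
Proof.
apply: dot_inj => al.
have [a [<- e0]] := tangent_onto al (dot0l (G x) (X x)).
by have := tension_dot a; rewrite e0 !dot0r addr0 oppr0 sub0r dotNl.
Qed.

Lemma tension_vertical : nab G b (tension G H h x) u (h x) =
  normsq_cov G e X x *: X x - rough_laplacian G e X x.
Proof.
have Ux := NU Nx.
apply: dot_inj => al.
(* Only vectors orthogonal to [X] are vertical parts of tangent vectors, so the test vector [al] is
   projected first. Its component along [X] pairs to 0 with both sides: on the left by [tangent], on
   the right by [rough_laplacian_unit]. *)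
pose be := al - dot (G x) al (X x) *: X x.
have beX : dot (G x) be (X x) = 0 by rewrite dotBl dotZl X1 // mulr1 subrr.
have [a [a0 ae]] := tangent_onto 0 beX.
have := tension_dot a; rewrite a0 ae !dot0r add0r subr0 /be !dotBr !dotZr.
rewrite tangent (rough_laplacian_unit oe Ox) mulr0 subr0 => ->.
by rewrite dotBl dotZl (dotC (X x) _ (sG x)); ring.
Qed.

(** [X_* X] is the horizontal lift of [X] plus the vertical lift of [nabla_X X]. Under [J] the first
    becomes the unit normal, which the term [eta] removes since [g(X, X) = 1]; the second becomes
    the horizontal lift with a minus sign. *)
Lemma phi_section :
  phi G (row_mx x (X x)) (dd (X x) (fun y => row_mx y (X y)) x) =
  - hlift G (row_mx x (X x)) (cov G X X x).
Proof.
have Ux := NU Nx; set z := row_mx x (X x).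
have bz : base z = x by rewrite /base row_mxKl.
have fz : fiber z = X x by rewrite /fiber row_mxKr.
have dX := smooth_diff sX Ux.
have -> : dd (X x) (fun y => row_mx y (X y)) x = row_mx (X x) (dd (X x) X x).
  rewrite dd_row_mx ?dd_id //; exact: differentiable_id.
rewrite covE nab_id; set P := _ + _.
have hA : hpart (row_mx (X x) (dd (X x) X x)) = X x by rewrite /hpart row_mxKl.
have vA : vpart G z (row_mx (X x) (dd (X x) X x)) = P.
  by rewrite /vpart row_mxKl row_mxKr bz fz.
rewrite /phi /eta /xi /Unormal Jtm_vlift opprK fz.
rewrite /sasaki hpart_hlift vpart_hlift hA dot0l addr0 bz X1 // scale1r.
by rewrite /Jtm hA vA addrAC subrr sub0r.
Qed.

(** The second block of coordinates mixes the vertical part with a Christoffel term of the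
    horizontal part. The first block is the curvature equation; once it holds, the Christoffel terms
    on both sides agree and the second block says that the vertical part vanishes. *)
Lemma magnetic_local q :
  dd (tension G H h x) iota (h x) =
    q *: phi G (row_mx x (X x)) (dd (X x) (fun y => row_mx y (X y)) x) <->
  tr_curv G e X x = q *: cov G X X x /\
  rough_laplacian G e X x = normsq_cov G e X x *: X x.
Proof.
have Wh := NW Nx; set t := tension G H h x.
have iE : dd t iota (h x) = row_mx (dd t b (h x)) (dd t u (h x)).
  rewrite -dd_row_mx; [|exact: smooth_diff sb _ Wh|exact: smooth_diff su _ Wh].
  by under [in RHS]eq_fun do rewrite hsubmxK.
have vE : nab G b t u (h x) = dd t u (h x) + Gam G x (dd t b (h x)) (X x).
  by rewrite /nab (bh Nx) (uh Nx).
have hE Z : hlift G (row_mx x (X x)) Z = row_mx Z (- Gam G x Z (X x)).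
  by rewrite /hlift /base /fiber row_mxKl row_mxKr.
have t1 := tension_horizontal; have t2 := tension_vertical.
rewrite -/t in t1 t2.
rewrite iE phi_section hE opp_row_mx opprK scale_row_mx.
have GE : dd t b (h x) = - (q *: cov G X X x) ->
    Gam G x (dd t b (h x)) (X x) = - (q *: Gam G x (cov G X X x) (X x)).
  by move=> ->; rewrite -scaleNr GamZl scaleNr.
split=> [/eq_row_mx[e1 e2]|[e1 e2]].
  move: e1; rewrite scalerN => e1; split.
    by apply: oppr_inj; rewrite -t1.
  have : nab G b t u (h x) = 0 by rewrite vE (GE e1) e2 subrr.
  by rewrite t2 => /subr0_eq.
have e1' : dd t b (h x) = - (q *: cov G X X x) by rewrite t1 e1.
congr row_mx; first by rewrite scalerN.
by apply: subr0_eq; rewrite -[LHS]/(_ + - _) -(GE e1') -vE t2 e2 subrr.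
Qed.

End LocalEquivalence.

(** * Immersions into the unit tangent bundle *)

Lemma posdef_unitmx (R : realType) (n : nat) (A : 'M[R]_n) :
  (forall v, v != 0 -> 0 < dot A v v) -> A \in unitmx.
Proof.
move=> pA; rewrite -row_free_unit -kermx_eq0; apply/rowV0P => v /sub_kermxP vA.
by apply/eqP; apply: contraT => /pA; rewrite /dot vA mul0mx mxE ltxx.
Qed.

(** The row space of [A] lies in the kernel of [L], and both have dimension [k]. *)
Lemma hyperplane_submx (K : fieldType) (k m : nat) (A : 'M[K]_(k, m))
    (L : 'cV[K]_m) (v : 'rV[K]_m) :
  m = k.+1 -> row_free A -> L != 0 -> A *m L = 0 -> v *m L = 0 ->
  exists a, v = a *m A.
Proof.
move=> mk fA L0 AL vL; apply/submxP.
have rL : \rank L = 1%N.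
  by apply/eqP; rewrite eqn_leq rank_leq_col lt0n mxrank_eq0.
have rk : \rank (kermx L) = k by rewrite mxrank_ker rL mk subn1.
have Ak : (A <= kermx L)%MS by apply/sub_kermxP.
have := mxrank_leqif_sup Ak; rewrite rk (eqP fA) => -[_ /esym].
by rewrite eqxx => kA; apply: submx_trans kA; apply/sub_kermxP.
Qed.

(** * Components of vectors and metrics in a chart *)

Section ChartFacts.
Context {R : realType} {n : nat}.
Variable M : manifold R n.
Implicit Types (c d : chart R M n).

Lemma cinvK (T : Type) (k : nat) (c : chart R T k) y : cimg c y ->
  cdom c (cinv c y) /\ c (cinv c y) = y.
Proof. by move=> [p cp <-]; rewrite chartK. Qed.

Lemma tvec_linear c y : atlas c -> cimg c y -> linear_map (tvec c y).
Proof.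
move=> ac cy; apply: derivative_linear.
apply: (atlas_compat ac (atlas_chart_at (cinv c y)) [::]).
by split=> //; exact: cdom_chart_at.
Qed.

Lemma tcoordK c y w : atlas c -> cimg c y ->
  tcoord c (cinv c y) (tvec c y w) = w.
Proof.
move=> ac cy; have [cp cE] := cinvK cy.
rewrite /tcoord /tvec -[in LHS]cE.
rewrite [cinv c (c (cinv c y))]chartK //.
exact: (transitionK _ ac (atlas_chart_at _) cp (cdom_chart_at _)).
Qed.

Lemma tvecK c y w : atlas c -> cimg c y -> tvec c y (tcoord c (cinv c y) w) = w.
Proof.
move=> ac cy; have [cp cE] := cinvK cy.
have := tchartK ac (cp : tdom c (cinv c y, w)).
rewrite /tinv /tfun /= /base /fiber row_mxKl row_mxKr cE.
by move=> /(congr1 snd).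
Qed.

Variable g : riemannian M.

Lemma mcomp_sym c y : (mcomp c g y)^T = mcomp c g y.
Proof.
by apply/matrixP => i j; rewrite !mxE; apply: dotC; exact: Defs.metric_sym.
Qed.

Lemma dot_mcomp c y v w : atlas c -> cimg c y ->
  dot (mcomp c g y) v w = dot (g (cinv c y)) (tvec c y v) (tvec c y w).
Proof.
move=> ac cy; have lt := tvec_linear ac cy.
pose B v w := dot (g (cinv c y)) (tvec c y v) (tvec c y w).
apply: (@linear_map_ext R n R^o (fun v => dot (mcomp c g y) v w) (B ^~ w)).
- exact: linear_map_dotl.
- exact: (linear_map_comp (@linear_map_dotl R n _ _) lt).
move=> i; 
  apply: (@linear_map_ext R n R^o (dot (mcomp c g y) (dx i)) (B (dx i))).
- exact: linear_map_dotr.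
- exact: (linear_map_comp (@linear_map_dotr R n _ _) lt).
by move=> j; rewrite dot_dx mxE.
Qed.

Lemma mcomp_pos c y v : atlas c -> cimg c y -> v != 0 ->
  0 < dot (mcomp c g y) v v.
Proof.
move=> ac cy v0; rewrite dot_mcomp //; apply: metric_pos.
apply: contraNneq v0 => e; rewrite -(tcoordK v ac cy) e /tcoord.
by rewrite derive0.
Qed.

Lemma vcomp_unit c X y : atlas c -> cimg c y -> unit_field g X ->
  dot (mcomp c g y) (vcomp c X y) (vcomp c X y) = 1.
Proof. by move=> ac cy X1; rewrite dot_mcomp // /vcomp tvecK. Qed.

Lemma tfun_lift c X y : cimg c y ->
  tfun c (lift_field X (cinv c y)) = row_mx y (vcomp c X y).
Proof. by move=> cy; rewrite /tfun /lift_field /= (cinvK cy).2. Qed.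

Lemma UM_fiber c u : atlas c -> tdom c u -> UM g u ->
  dot (mcomp c g (base (tfun c u))) (fiber (tfun c u)) (fiber (tfun c u)) = 1.
Proof.
move=> ac cu; rewrite /UM /=; case: u cu => p v /= cp v1.
have {}cp : cdom c p by [].
have cy : cimg c (c p) by exists p.
have := tvecK v ac cy; rewrite chartK // => tE.
by rewrite /tfun /base /fiber row_mxKl row_mxKr dot_mcomp //= tE chartK.
Qed.

End ChartFacts.

Section SasakiPullback.
Context {R : realType} {n k : nat}.
Variables (G : 'rV[R]_n -> 'M[R]_n) (iota : 'rV[R]_k -> 'rV[R]_(n + n)).
Local Notation b := (fun y => base (iota y)).
Local Notation u := (fun y => fiber (iota y)).

Lemma dd_base_fiber y v : differentiable iota y ->
  dd v iota y = row_mx (dd v b y) (dd v u y).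
Proof.
move=> di; rewrite -dd_row_mx.
- by under [in RHS]eq_fun do rewrite hsubmxK.
- exact: (differentiable_comp di (differentiable_lsubmx _)).
- exact: (differentiable_comp di (differentiable_rsubmx _)).
Qed.

Lemma vpart_dd y v : differentiable iota y ->
  vpart G (iota y) (dd v iota y) = nab G b v u y.
Proof. by move=> di; rewrite dd_base_fiber // /vpart row_mxKl row_mxKr. Qed.

Lemma hpart_dd y v : differentiable iota y -> hpart (dd v iota y) = dd v b y.
Proof. by move=> di; rewrite dd_base_fiber // /hpart row_mxKl. Qed.

Lemma pullback_coord Q y i j : pullback Q iota y i j =
  Q (iota y) (dd (dx i) iota y) (dd (dx j) iota y).
Proof. by rewrite mxE !ddE. Qed.

Lemma pullback_sasakiE y v w : differentiable iota y ->
  dot (pullback (sasaki G) iota y) v w =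
  dot (G (b y)) (dd v b y) (dd w b y) +
  dot (G (b y)) (nab G b v u y) (nab G b w u y).
Proof.
move=> di.
have db : differentiable b y.
  exact: (differentiable_comp di (differentiable_lsubmx _)).
have du : differentiable u y.
  exact: (differentiable_comp di (differentiable_rsubmx _)).
have lb : linear_map (fun v => dd v b y) by move=> *; exact: dd_linear.
have lu : linear_map (fun v => nab G b v u y) by exact: nab_linear.
pose B v w := dot (G (b y)) (dd v b y) (dd w b y) +
  dot (G (b y)) (nab G b v u y) (nab G b w u y).
rewrite -/(B v w).
have lB1 w' : linear_map (B ^~ w').
  apply: (@linear_mapD R k R^o).
    exact: (linear_map_comp (@linear_map_dotl R n _ _) lb).
  exact: (linear_map_comp (@linear_map_dotl R n _ _) lu).
have lB2 v' : linear_map (B v').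
  apply: (@linear_mapD R k R^o).
    exact: (linear_map_comp (@linear_map_dotr R n _ _) lb).
  exact: (linear_map_comp (@linear_map_dotr R n _ _) lu).
set H := pullback _ _ _.
apply: (@linear_map_ext R k R^o (fun v => dot H v w) (B ^~ w)) => // [|i].
  exact: linear_map_dotl.
apply: (@linear_map_ext R k R^o (dot H (dx i)) (B (dx i))) => // [|j].
  exact: linear_map_dotr.
by rewrite dot_dx /H pullback_coord /sasaki !hpart_dd // !vpart_dd.
Qed.

Lemma pullback_sasaki_sym y : (forall x, (G x)^T = G x) ->
  (pullback (sasaki G) iota y)^T = pullback (sasaki G) iota y.
Proof.
move=> sG; apply/matrixP => i j; rewrite mxE !pullback_coord /sasaki.
by rewrite dotC // [X in _ + X]dotC.
Qed.

End SasakiPullback.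

Section UnitImmersion.
Context {R : realType} {n k : nat}.
Variables (G : 'rV[R]_n -> 'M[R]_n) (U : set 'rV[R]_n).
Hypotheses (oU : open U) (sG : forall x, (G x)^T = G x) (smG : smooth_on U G).
Hypothesis posG : forall x v, U x -> v != 0 -> 0 < dot (G x) v v.
Variables (iota : 'rV[R]_k -> 'rV[R]_(n + n)) (W : set 'rV[R]_k).
Local Notation b := (fun y => base (iota y)).
Local Notation u := (fun y => fiber (iota y)).
Hypotheses (oW : open W) (WU : forall y, W y -> U (b y)).
Hypothesis si : smooth_on W iota.
Hypothesis unit_u : forall y, W y -> dot (G (b y)) (u y) (u y) = 1.
Variables (Q : set 'rV[R]_(n + n)) (F : 'rV[R]_(n + n) -> 'rV[R]_k).
Hypothesis WQ : forall y, W y -> Q (iota y).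
Hypotheses (sF : smooth_on Q F) (FK : forall y, W y -> F (iota y) = y).
Hypothesis dimk : (n + n)%N = k.+1.

Local Notation H := (pullback (sasaki G) iota).

Let uG x : U x -> G x \in unitmx.
Proof. by move=> Ux; apply: posdef_unitmx => v; exact: posG. Qed.
Let sb : smooth_on W b. Proof. exact: smooth_lsubmx. Qed.
Let su : smooth_on W u. Proof. exact: smooth_rsubmx. Qed.
Let HE y v w : W y -> dot (H y) v w =
  dot (G (b y)) (dd v b y) (dd w b y) +
  dot (G (b y)) (nab G b v u y) (nab G b w u y).
Proof. by move=> Wy; apply: pullback_sasakiE; exact: smooth_diff si _ Wy. Qed.

(** The hypotheses force [dd v iota y = 0], the Christoffel term in [nab] vanishing with [dd v b y];
    differentiating [F (iota y) = y] then gives [v = 0]. *)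
Lemma immersion_inj y v : W y ->
  dd v b y = 0 -> nab G b v u y = 0 -> v = 0.
Proof.
move=> Wy v0; rewrite /nab v0 Gam0l addr0 => u0.
have di := smooth_diff si Wy.
have := dd_id y v; rewrite -(near_eq_dd v (near_open oW Wy FK)).
rewrite -[X in dd v X]/(F \o iota) dd_comp //;
  last exact: smooth_diff sF _ (WQ Wy).
by rewrite dd_base_fiber // v0 u0 row_mx0 ddE derive0.
Qed.

Lemma smooth_pullback_sasaki : smooth_on W H.
Proof.
apply/(smooth_mxP oW) => i j.
have sdb v : smooth_on W (dd v b) by exact: smooth_dd.
have snu v : smooth_on W (nab G b v u).
  exact: (smooth_nab oU smG uG oW WU sb v su).
have sGb : smooth_on W (G \o b) by exact: (smooth_metric_along oU smG oW WU sb).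
apply: (eq_smooth oW _ (smoothD oW (smooth_dot oW sGb (sdb (dx i)) (sdb (dx j)))
                          (smooth_dot oW sGb (snu (dx i)) (snu (dx j))))).
by move=> y Wy; rewrite -[RHS]dot_dx HE.
Qed.

Lemma pullback_sasaki_unit y : W y -> H y \in unitmx.
Proof.
move=> Wy; apply: posdef_unitmx => v v0; rewrite HE //.
have Ux := WU Wy.
have ge0 w : 0 <= dot (G (b y)) w w.
  have [->|w0] := eqVneq w 0; first by rewrite dot0l.
  by apply: ltW; exact: posG.
have [b0|b0] := eqVneq (dd v b y) 0; last first.
  by rewrite ltr_pwDl // posG.
have [u0|u0] := eqVneq (nab G b v u y) 0; last first.
  by rewrite ltr_wpDl // posG.
by move: v0; rewrite (immersion_inj Wy b0 u0) eqxx.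
Qed.

Lemma unit_tangent y a : W y -> dot (G (b y)) (nab G b a u y) (u y) = 0.
Proof.
move=> Wy; have := nab_metric oU sG smG uG oW WU sb a Wy su su.
rewrite (near_eq_dd _ (near_open oW Wy unit_u)) dd_cst (dotC (u y) _ (sG _)).
by move=> /eqP; rewrite eq_sym -mulr2n mulrn_eq0 /= => /eqP.
Qed.

(** A dimension count: the differential of [iota] is injective on a space of dimension [2n - 1], and
    its image lies in the kernel of a nonzero linear form on a space of dimension [2n]. *)
Lemma unit_tangent_onto y al be : W y -> dot (G (b y)) be (u y) = 0 ->
  exists a, dd a b y = al /\ nab G b a u y = be.
Proof.
move=> Wy beu; have di := smooth_diff si Wy.
pose A : 'M[R]_(k, n + n) := \matrix_(a < k) dd (dx a) iota y.
have AE v : v *m A = dd v iota y.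
  rewrite dd_sum_dx //; apply/rowP => j; rewrite mxE summxE.
  by apply: eq_bigr => a _; rewrite !mxE.
(* The vertical part of [z] paired with [u], which is half the differential of the squared length on
   the tangent bundle; it takes the value 1 on the unit normal. *)
pose f (z : 'rV[R]_(n + n)) :=
  dot (G (b y)) (rsubmx z + Gam G (b y) (lsubmx z) (u y)) (u y).
have lf : linear_map (f : _ -> R^o).
  apply: (linear_map_comp (@linear_map_dotl R n _ _)); apply: linear_mapD.
    by move=> c z1 z2; rewrite linearP.
  apply: (linear_map_comp (@linear_map_Gaml R n G (b y) (u y))).
  by move=> c z1 z2; rewrite linearP.
pose L : 'cV[R]_(n + n) := \col_i f (dx i).
have LE z : z *m L = (f z)%:M.
  rewrite [f z](linear_map_sum _ lf); apply/rowP => j.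
  rewrite (ord1 j) !mxE eqxx mulr1n.
  by apply: eq_bigr => i _; rewrite mxE.
have fA : row_free A.
  rewrite -kermx_eq0; apply/rowV0P => v /sub_kermxP; rewrite AE.
  rewrite dd_base_fiber // -row_mx0 => /eq_row_mx[v0 u0].
  by apply: (immersion_inj Wy) => //; rewrite /nab u0 v0 Gam0l addr0.
have fv v : f (dd v iota y) = 0.
  rewrite /f dd_base_fiber // row_mxKl row_mxKr.
  exact: unit_tangent.
have L0 : L != 0.
  apply/eqP => L0; have := LE (row_mx 0 (u y)).
  rewrite L0 mulmx0 /f row_mxKl row_mxKr Gam0l addr0 unit_u // => /rowP /(_ 0).
  by rewrite !mxE eqxx mulr1n => /eqP; rewrite eq_sym oner_eq0.
have AL : A *m L = 0.
  apply/row_matrixP => i; rewrite row_mul row0 LE rowK fv.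
  by apply/rowP => j; rewrite !mxE mul0rn.
(* The vector with horizontal part [al] and vertical part [be], written in coordinates. *)
have vL : row_mx al (be - Gam G (b y) al (u y)) *m L = 0.
  rewrite LE /f row_mxKl row_mxKr subrK beu.
  by apply/rowP => j; rewrite !mxE mul0rn.
have [a] := hyperplane_submx dimk fA L0 AL vL.
rewrite AE dd_base_fiber // => /eq_row_mx[e1 e2]; exists a.
by rewrite /nab -e1 -e2 subrK.
Qed.

Variable X : 'rV[R]_n -> 'rV[R]_n.
Hypothesis sX : smooth_on U X.
Hypothesis X1 : forall x, U x -> dot (G x) (X x) (X x) = 1.
Variables (N : set 'rV[R]_n) (h : 'rV[R]_n -> 'rV[R]_k).
Hypotheses (oN : open N) (NU : N `<=` U) (NW : forall x, N x -> W (h x)).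
Hypothesis sh : smooth_on N h.
Hypothesis ih : forall x, N x -> iota (h x) = row_mx x (X x).

Lemma magnetic_immersion O e x q : orthonormal_frame G U O e -> O x -> N x ->
  dd (tension G H h x) iota (h x) =
    q *: phi G (row_mx x (X x)) (dd (X x) (fun y => row_mx y (X y)) x) <->
  tr_curv G e X x = q *: cov G X X x /\
  rough_laplacian G e X x = normsq_cov G e X x *: X x.
Proof.
move=> oe Ox Nx; have Wh := NW Nx.
have bx : b (h x) = x by rewrite /= ih // /base row_mxKl.
have ux : u (h x) = X x by rewrite /= ih // /fiber row_mxKr.
apply: (magnetic_local oU sG smG uG sX X1 oW WU si
  (pullback_sasaki_sym iota ^~ sG) smooth_pullback_sasaki pullback_sasaki_unit
    HE oN NU NW sh ih Nx) oe Ox q.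
- by move=> v; apply: posG; exact: NU.
- by move=> a; have := unit_tangent a Wh; rewrite bx ux.
- by move=> al be; have := @unit_tangent_onto _ al be Wh; rewrite bx ux.
Qed.

End UnitImmersion.

(** * The equivalence at a point of the manifold *)

Section MagneticAt.
Context {R : realType} {n : nat} {M : manifold R n}.
Variables (g : riemannian M) (X : M -> 'rV[R]_n).
Hypotheses (smooth_X : smooth_field X) (unit_X : unit_field g X).
Variables (c : chart R M n) (psi : chart R (TM M) (n + n).-1).
Hypotheses (ac : atlas c) (upsi : UM_chart g psi).

Lemma UM_chart_incl : exists W, [/\ open W, smooth_on W (UM_incl c psi),
  forall v, cdom c v.1 -> cdom psi v -> W (psi v)
  & forall y, W y -> exists v,
      [/\ UM g v, cdom c v.1, psi v = y & cinv psi y = v]].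
Proof.
have [psiU psiS _] := upsi.
have tac : tm_atlas (tchart ac) by exists c, ac.
have [oW sW] := psiS _ tac.
exists (cimg psi `&` cinv psi @^-1` tdom c); split=> //.
  move=> v cv pv; split; first by exists v.
  by rewrite /preimage /= chartK.
move=> y [[v pv <-]]; rewrite /preimage /= chartK // => cv.
by exists v; split=> //; exact: psiU.
Qed.

Lemma UM_chart_extension u : cdom c u.1 -> cdom psi u ->
  exists Q F, [/\ open Q, Q (tfun c u), smooth_on Q F
    & forall v, UM g v -> cdom c v.1 -> Q (tfun c v) ->
        cdom psi v /\ psi v = F (tfun c v)].
Proof.
have [_ _ psiF] := upsi.
have tac : tm_atlas (tchart ac) by exists c, ac.
exact: psiF _ u tac.
Qed.

(** Makes the predecessor in [(n + n).-1] a genuine one: over a point of a manifold of dimension 0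
    there is no unit vector. *)
Lemma unit_field_dim (p : M) : (0 < n)%N.
Proof.
rewrite lt0n; apply/eqP => n0; have := unit_X p.
rewrite dotE big1 => [/eqP|i _]; first by rewrite eq_sym oner_eq0.
by have := ltn_ord i; rewrite {2}n0.
Qed.

Lemma magnetic_at_point (p : M) q O e :
  cdom c p -> cdom psi (lift_field X p) ->
  orthonormal_frame (mcomp c g) (cimg c) O e -> O (c p) ->
  (let h := psi \o lift_field X \o cinv c in
    let Xl := tfun c \o lift_field X \o cinv c in
    let tau := tension (mcomp c g) (UM_metric g c psi) h (c p) in
    let dX_X := 'D_(vcomp c X (c p)) Xl (c p) in
    'D_tau (UM_incl c psi) (h (c p)) = q *: phi (mcomp c g) (Xl (c p)) dX_X) <->
  tr_curv (mcomp c g) e (vcomp c X) (c p) =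
    q *: cov (mcomp c g) (vcomp c X) (vcomp c X) (c p) /\
  rough_laplacian (mcomp c g) e (vcomp c X) (c p) =
    normsq_cov (mcomp c g) e (vcomp c X) (c p) *: vcomp c X (c p).
Proof.
move=> cp pp oe Ocp; cbv zeta.
set h := psi \o lift_field X \o cinv c.
set Xl := tfun c \o lift_field X \o cinv c.
have [W0 [oW0 si0 W0p W0E]] := UM_chart_incl.
have [Q [F [oQ Qp sF FE]]] := @UM_chart_extension (lift_field X p) cp pp.
pose Xr y := row_mx y (vcomp c X y).
have oU : open (cimg c) by exact: open_cimg.
have sX : smooth_on (cimg c) (vcomp c X) by exact: smooth_X.
have Ux : cimg c (c p) by exists p.
have XlE y : cimg c y -> Xl y = Xr y by exact: tfun_lift.
have sXr : smooth_on (cimg c) Xr.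
  by apply: smooth_row_mx => //; exact: smooth_id.
(* On [Q] the chart [psi] extends to the smooth map [F] of the tangent bundle. [W] and [N] are cut
   down so that [iota] and the field stay in [Q]. *)
pose W := W0 `&` UM_incl c psi @^-1` Q.
have oW : open W.
  apply: (continuous_inP _ oW0).1 oQ => y /set_mem W0y.
  by apply: differentiable_continuous; exact: smooth_diff si0 _ W0y.
have si : smooth_on W (UM_incl c psi) by apply: smooth_sub si0 => y [].
pose N := cimg c `&` Xr @^-1` Q.
have oN : open N.
  apply: (continuous_inP _ oU).1 oQ => y /set_mem Uy.
  by apply: differentiable_continuous; exact: smooth_diff sXr _ Uy.
have NU : N `<=` cimg c by move=> y [].
have cinvp : cinv c (c p) = p by exact: chartK.
have Nx : N (c p).
  split; first exact: Ux.
  by rewrite -[_ (c p)]/(Q (Xr (c p))) -(XlE _ Ux) /Xl /= cinvp.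
(* The extension property also keeps nearby unit vectors in the domain of [psi]. The identity of [h]
   with [F] after [Xr] is what makes [h] smooth. *)
have NF y : N y -> cdom psi (lift_field X (cinv c y)) /\ h y = F (Xr y).
  move=> [Uy Qy]; have [cy cE] := cinvK Uy.
  rewrite /preimage /= -(XlE y Uy) in Qy.
  have [d e1] := FE (lift_field X (cinv c y)) (unit_X _) cy Qy.
  by split=> //; rewrite -(XlE y Uy) -[h y]/(psi _) e1.
have ih y : N y -> UM_incl c psi (h y) = Xr y.
  move=> Ny; have [d _] := NF y Ny.
  by rewrite -(XlE y (NU y Ny)) /UM_incl /h /= chartK.
have NW y : N y -> W (h y).
  move=> Ny; have [d _] := NF y Ny; have [cy _] := cinvK (NU y Ny).
  split; first exact: W0p.
  by rewrite -[_ (h y)]/(Q (UM_incl c psi (h y))) (ih y Ny); case: Ny.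
have sh : smooth_on N h.
  apply: (@eq_smooth _ _ _ oN _ (F \o Xr)) => [y Ny|].
    by have [_ ->] := NF y Ny.
  by apply: (smooth_comp oN oQ (smooth_sub NU sXr) _ sF) => y [].
have iE y v : cdom c v.1 -> cinv psi y = v -> UM_incl c psi y = tfun c v.
  by move=> _ <-.
have WU y : W y -> cimg c (base (UM_incl c psi y)).
  move=> [/W0E[v [v1 cv _ yv]] _]; rewrite (iE y v cv yv) /base row_mxKl.
  by exists v.1.
have unit_u y : W y -> dot (mcomp c g (base (UM_incl c psi y)))
    (fiber (UM_incl c psi y)) (fiber (UM_incl c psi y)) = 1.
  move=> [/W0E[v [v1 cv _ yv]] _]; rewrite (iE y v cv yv).
  exact: UM_fiber.
have WQ y : W y -> Q (UM_incl c psi y) by case.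
have FK y : W y -> F (UM_incl c psi y) = y.
  move=> [/W0E[v [v1 cv vy yv]] Qy]; rewrite /preimage /= in Qy.
  by rewrite (iE y v cv yv) in Qy *; have [_ <-] := FE v v1 cv Qy.
have dimk : (n + n)%N = (n + n).-1.+1.
  by rewrite prednK // addn_gt0 (unit_field_dim p).
have posG y v : cimg c y -> v != 0 -> 0 < dot (mcomp c g y) v v.
  by move=> Uy; exact: mcomp_pos.
have X1 y : cimg c y -> dot (mcomp c g y) (vcomp c X y) (vcomp c X y) = 1.
  by move=> Uy; exact: vcomp_unit.
have <- := magnetic_immersion oU (mcomp_sym g c) (metric_smooth g ac) posG
  oW WU si unit_u WQ sF FK dimk sX X1 oN NU NW sh ih q oe Ocp Nx.
rewrite !ddE (XlE _ Ux).
rewrite (@near_eq_derive _ _ _ Xl Xr (c p) (vcomp c X (c p))) //.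
exact: near_open oU Ux XlE.
Qed.

End MagneticAt.

(** * Orthonormal frames *)

Section Frames.
Context {R : realType} {n : nat}.
Local Notation E := 'rV[R]_n.
Variables (G : E -> 'M[R]_n) (U : set E).
Hypotheses (oU : open U) (sG : forall x, (G x)^T = G x) (smG : smooth_on U G).
Hypothesis posG : forall x v, U x -> v != 0 -> 0 < dot (G x) v v.

(** Applied to the coordinate fields, which exist on all of [U]. The triangular shape in the last
    clause stands for linear independence: it gives the next vector, before normalization, the
    coordinate 1 in position [k], so it never vanishes. *)
Lemma gram_schmidt k : (k <= n)%N -> exists f : nat -> E -> E,
  [/\ forall i, (i < k)%N -> smooth_on U (f i),
      forall x, U x -> forall i j, (i < k)%N -> (j < k)%N ->
        dot (G x) (f i x) (f j x) = (i == j)%:R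
    & forall x (i : nat) (j : 'I_n), (i < k)%N -> (i < j)%N -> f i x 0 j = 0].
Proof.
elim: k => [_|k IH kn]; first by exists (fun _ _ => 0); split.
have [f [sf fo f0]] := IH (ltnW kn).
pose d : E := dx (Ordinal kn).
pose w x := d - \sum_(i < k) dot (G x) d (f i x) *: f i x.
have w0 x : w x != 0.
  apply/eqP => /(congr1 (fun v : E => v 0 (Ordinal kn))).
  rewrite !mxE summxE big1 ?subr0 ?eqxx => [/eqP|i _].
    by rewrite oner_eq0.
  by rewrite mxE f0 ?mulr0.
have wpos x : U x -> 0 < dot (G x) (w x) (w x) by move=> Ux; exact: posG.
have scd : smooth_on U (fun=> d) by exact: smooth_cst.
have sw : smooth_on U w.
  apply: smoothD => //; apply: smoothN => //; apply: smooth_sum => // i.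
  have sfi := sf i (ltn_ord i).
  exact: (smooth_scale oU (smooth_dot oU smG scd sfi) sfi).
have wf x j : U x -> (j < k)%N -> dot (G x) (w x) (f j x) = 0.
  move=> Ux jk; rewrite dotBl dot_suml (bigD1 (Ordinal jk)) //= dotZl fo //.
  rewrite eqxx mulr1 big1 ?addr0 ?subrr // => i ij.
  by rewrite dotZl fo // [_ == _](negbTE ij) mulr0.
pose fk x := (Num.sqrt (dot (G x) (w x) (w x)))^-1 *: w x.
have sfk : smooth_on U fk.
  apply: smooth_scale => //; apply: smoothV => // [x Ux|].
    by rewrite gt_eqF // sqrtr_gt0 wpos.
  by apply: smooth_sqrt => //; exact: smooth_dot.
have ltk i : (i < k.+1)%N -> i != k -> (i < k)%N.
  by move=> ik ine; rewrite ltn_neqAle ine.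
exists (fun i => if i == k then fk else f i); split.
- by move=> i ik; have [//|ine] := eqVneq i k; apply: sf; exact: ltk.
- move=> x Ux i j ik jk; have [eik|ine] := eqVneq i k;
    have [ejk|jne] := eqVneq j k.
  + rewrite eik ejk eqxx dotZl dotZr mulrA -invfM -expr2.
    rewrite sqr_sqrtr ?ltW ?wpos //.
    by rewrite mulVf // gt_eqF // wpos.
  + by rewrite dotZl wf ?ltk // mulr0 eik eq_sym (negbTE jne).
  + by rewrite dotZr (dotC _ _ (sG x)) wf ?ltk // mulr0 ejk (negbTE ine).
  + by apply: fo; rewrite ?ltk.
- move=> x i j ik; have [->|ine] := eqVneq i k.
    move=> kj; rewrite !mxE summxE big1 ?subr0 => [|l _].
      by rewrite eqxx /= -val_eqE /= gtn_eqF // mulr0.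
    by rewrite mxE f0 ?mulr0 //; exact: ltn_trans kj.
  by apply: f0; exact: ltk.
Qed.

Lemma orthonormal_frame_exists : exists e, orthonormal_frame G U U e.
Proof.
have [f [sf fo _]] := gram_schmidt (leqnn n).
exists (fun i => f i); split => // [i|x Ux i j]; first exact: sf.
by rewrite fo.
Qed.

Lemma orthonormal_frameN O e : orthonormal_frame G U O e ->
  orthonormal_frame G U O (fun i x => - e i x).
Proof.
move=> [oO OU se oe]; split=> // [i|x Ox i j]; first exact: smoothN.
by rewrite dotNl dotNr opprK oe.
Qed.

(** Write [v] as [v A A^-1] and insert the expression of [A^-1] as the sum of the tensor squares of
    the frame vectors. *)
Lemma frame_expand (A : 'M[R]_n) (e : 'I_n -> E) v :
  (forall i j, dot A (e i) (e j) = (i == j)%:R) ->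
  v = \sum_i dot A v (e i) *: e i.
Proof.
move=> oe; have uA := frame_unitmx oe.
rewrite -[LHS]mulmx1 -(mulmxV uA) (invmx_frame oe) mulmxA.
apply/rowP => j; rewrite mxE summxE.
under eq_bigr => i _ do rewrite [X in _ * X]mxE mulr_sumr.
rewrite exchange_big /=; apply: eq_bigr => a _.
rewrite [RHS]mxE /dot [in RHS]mxE mulr_suml; apply: eq_bigr => i _.
by rewrite !mxE mulrA.
Qed.

Lemma dot_frame (A : 'M[R]_n) (e : 'I_n -> E) (r s : 'I_n -> R) :
  (forall i j, dot A (e i) (e j) = (i == j)%:R) ->
  dot A (\sum_i r i *: e i) (\sum_i s i *: e i) = \sum_i r i * s i.
Proof.
move=> oe; rewrite dot_suml; apply: eq_bigr => i _.
rewrite dotZl dot_sumr (bigD1 i) //= big1 ?addr0 => [|j ji].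
  by rewrite dotZr oe eqxx mulr1.
by rewrite dotZr oe eq_sym (negbTE ji) mulr0.
Qed.

End Frames.

(** * Stereographic charts of the unit tangent bundle *)

Section Transition.
Context {R : realType} {n : nat} {M : manifold R n}.
Implicit Types c d : chart R M n.

Definition overlap c d : set 'rV[R]_n := cimg c `&` cinv c @^-1` cdom d.

(** The change of charts of the tangent bundle, written without the charts [chart_at], which depend
    on the point in an uncontrolled way. In this form it is visibly smooth; the chain rule in
    [tfun_trans] eliminates the chosen charts. *)
Definition trans c d (z : 'rV[R]_(n + n)) : 'rV[R]_(n + n) :=
  row_mx (d (cinv c (base z))) (dd (fiber z) (d \o cinv c) (base z)).

Lemma open_overlap c d : atlas c -> atlas d -> open (overlap c d).
Proof.
move=> ac ad; have oc : open (cimg c) by exact: open_cimg.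
apply: (continuous_inP (cinv c) oc).1; last exact: atlas_open.
by rewrite -(continuous_open_subspace (cinv c) oc); exact: atlas_continuousV.
Qed.

Lemma overlapP c d p : cdom c p -> cdom d p -> overlap c d (c p).
Proof. by move=> cp dp; split; [exists p|rewrite /preimage /= chartK]. Qed.

Lemma open_base (A : set 'rV[R]_n) : open A -> open (base @^-1` A).
Proof.
by move=> oA; apply: open_comp => // z _; exact: continuous_lsubmx.
Qed.

Lemma smooth_base (A : set 'rV[R]_(n + n)) : open A -> smooth_on A base.
Proof. by move=> oA; apply: (smooth_lsubmx oA); exact: smooth_id. Qed.

Lemma smooth_fiber (A : set 'rV[R]_(n + n)) : open A -> smooth_on A fiber.
Proof. by move=> oA; apply: (smooth_rsubmx oA); exact: smooth_id. Qed.

Lemma smooth_trans c d : atlas c -> atlas d ->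
  smooth_on (base @^-1` overlap c d) (trans c d).
Proof.
move=> ac ad; have oS := open_overlap ac ad; have oB := open_base oS.
have st : smooth_on (overlap c d) (d \o cinv c) by exact: atlas_compat.
have sbase := smooth_base oB.
apply: (smooth_row_mx oB); first exact: (smooth_comp oB oS sbase _ st).
apply: (@eq_smooth _ _ _ oB _ (fun z =>
    \sum_i fiber z 0 i *: (dd (dx i) (d \o cinv c) \o base) z)) => [z Sz|].
  by rewrite [RHS]dd_sum_dx //; exact: smooth_diff st _ Sz.
apply: smooth_sum => // i; apply: smooth_scale => //.
  by have /(smooth_mxP oB) := smooth_fiber oB; exact.
exact: (smooth_comp oB oS sbase _ (smooth_dd _ st)).
Qed.

Lemma tfun_trans c d (v : TM M) : atlas c -> atlas d ->
  cdom c v.1 -> cdom d v.1 -> tfun d v = trans c d (tfun c v).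
Proof.
case: v => p v ac ad /= cp dp.
rewrite /trans /tfun /base /fiber row_mxKl row_mxKr /= chartK //; congr row_mx.
have ach := atlas_chart_at p; have hp := cdom_chart_at p.
set ch := chart_at p in ach hp *.
have oS := open_overlap ach ac.
have tcE (c' : chart R M n) w : tcoord c' p w = dd w (c' \o cinv ch) (ch p).
  by rewrite ddE.
rewrite !tcE.
have tE : c p = (c \o cinv ch) (ch p) by rewrite /= chartK.
have stc := smooth_diff (atlas_compat ach ac) (overlapP hp cp).
have std := smooth_diff (atlas_compat ac ad) (overlapP cp dp).
rewrite [X in _ = dd _ _ X]tE -dd_comp //; last by rewrite -tE.
apply: near_eq_dd; apply: near_open oS (overlapP hp cp) _ => y [_ cy] /=.
by rewrite chartK.
Qed.

Lemma tinvK c z : atlas c -> cimg c (base z) -> tfun c (tinv c z) = z.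
Proof.
move=> ac cz; have [_ cE] := cinvK cz.
by rewrite /tfun /tinv /= cE tcoordK // hsubmxK.
Qed.

End Transition.

Section Stereographic.
Context {R : realType} {m : nat}.
Local Notation E := 'rV[R]_m.+1.
Local Notation TE := 'rV[R]_(m.+1 + m.+1).
Local Notation Y := 'rV[R]_(m + m.+1).
Variables (G : E -> 'M[R]_m.+1) (U O : set E) (e : 'I_m.+1 -> E -> E).
Hypotheses (smG : smooth_on U G) (oe : orthonormal_frame G U O e).

Let oO : open O. Proof. by case: oe. Qed.
Let OU : O `<=` U. Proof. by case: oe. Qed.
Let se i : smooth_on O (e i). Proof. by case: oe. Qed.
Let eo x (Ox : O x) i j : dot (G x) (e i x) (e j x) = (i == j)%:R.
Proof. by have [_ _ _] := oe; exact. Qed.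

Definition frame_coord i (z : TE) : R :=
  dot (G (base z)) (fiber z) (e i (base z)).

(* Stereographic projection of the unit spheres from the pole - e_0. *)
Definition ster (z : TE) : Y :=
  row_mx (\row_j (frame_coord (lift ord0 j) z * (1 + frame_coord ord0 z)^-1))
    (base z).

Definition ster_den (y : Y) : R := 1 + \sum_j lsubmx y 0 j ^+ 2.

(** Inverse stereographic projection. With [t] the left block and [s = 1 + |t|^2], the coefficient
    along [e ord0] is [(1 - |t|^2) / s] and the others are [2 t_j / s]. *)
Definition ster_coef (y : Y) (i : 'I_m.+1) : R :=
  if unlift ord0 i is Some j then 2 * lsubmx y 0 j * (ster_den y)^-1
  else 2 * (ster_den y)^-1 - 1.

Definition sterV (y : Y) : TE :=
  row_mx (rsubmx y) (\sum_i ster_coef y i *: e i (rsubmx y)).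

Lemma ster_den_gt0 y : 0 < ster_den y.
Proof. by rewrite ltr_pwDl // sumr_ge0 // => j _; exact: sqr_ge0. Qed.

Lemma ster_coef0 y : ster_coef y ord0 = 2 * (ster_den y)^-1 - 1.
Proof. by rewrite /ster_coef unlift_none. Qed.

Lemma ster_coef_lift y j :
  ster_coef y (lift ord0 j) = 2 * lsubmx y 0 j * (ster_den y)^-1.
Proof. by rewrite /ster_coef liftK. Qed.

Lemma ster_coef_sphere y : \sum_i ster_coef y i * ster_coef y i = 1.
Proof.
have N0 : ster_den y != 0 by rewrite gt_eqF // ster_den_gt0.
rewrite big_ord_recl ster_coef0.
under eq_bigr => j _.
  rewrite ster_coef_lift.
  rewrite (_ : _ * _ = 4 * (ster_den y) ^- 2 * lsubmx y 0 j ^+ 2).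
    over.
  by field.
rewrite -mulr_sumr.
have -> : \sum_j lsubmx y 0 j ^+ 2 = ster_den y - 1.
  by rewrite /ster_den addrC addKr.
by field.
Qed.

Lemma base_sterV y : base (sterV y) = rsubmx y.
Proof. by rewrite /sterV /base row_mxKl. Qed.

Lemma frame_coord_sterV y i : O (rsubmx y) ->
  frame_coord i (sterV y) = ster_coef y i.
Proof.
move=> Oy; rewrite /frame_coord base_sterV /sterV /fiber row_mxKr dot_suml.
rewrite (bigD1 i) //= big1 ?addr0 => [|j ji].
  by rewrite dotZl eo // eqxx mulr1.
by rewrite dotZl eo // (negbTE ji) mulr0.
Qed.

Lemma sterV_unit y : O (rsubmx y) ->
  dot (G (base (sterV y))) (fiber (sterV y)) (fiber (sterV y)) = 1.
Proof.
move=> Oy; rewrite base_sterV /sterV /fiber row_mxKr.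
by rewrite (dot_frame _ _ (eo Oy)) ster_coef_sphere.
Qed.

Lemma ster_pole y : O (rsubmx y) ->
  1 + frame_coord ord0 (sterV y) = 2 * (ster_den y)^-1.
Proof. by move=> Oy; rewrite frame_coord_sterV // ster_coef0 addrC subrK. Qed.

Lemma sterVK y : O (rsubmx y) -> ster (sterV y) = y.
Proof.
move=> Oy; rewrite /ster base_sterV ster_pole // -[RHS]hsubmxK; congr row_mx.
have N0 : ster_den y != 0 by rewrite gt_eqF // ster_den_gt0.
apply/rowP => j; rewrite mxE frame_coord_sterV // ster_coef_lift.
by field; rewrite N0.
Qed.

Lemma sterK z : O (base z) -> dot (G (base z)) (fiber z) (fiber z) = 1 ->
  1 + frame_coord ord0 z != 0 -> sterV (ster z) = z.
Proof.
move=> Oz z1 p0.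
have rz : rsubmx (ster z) = base z by rewrite row_mxKr.
have lz j : lsubmx (ster z) 0 j =
    frame_coord (lift ord0 j) z * (1 + frame_coord ord0 z)^-1.
  by rewrite row_mxKl mxE.
have sum1 : \sum_i frame_coord i z * frame_coord i z = 1.
  by rewrite -z1 {1 2}(frame_expand (fiber z) (eo Oz)) (dot_frame _ _ (eo Oz)).
(* With [a] the coordinate along [e ord0] of the unit vector,
   [1 + (1 - a^2) / (1 + a)^2 = 2 / (1 + a)]. *)
have dE : ster_den (ster z) = 2 * (1 + frame_coord ord0 z)^-1.
  rewrite /ster_den; under eq_bigr => j _ do rewrite lz exprMn.
  rewrite -mulr_suml.
  have -> : \sum_j frame_coord (lift ord0 j) z ^+ 2 =
      1 - frame_coord ord0 z ^+ 2.
    by rewrite -sum1 big_ord_recl /= -expr2 addrAC subrr add0r.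
  by field.
rewrite /sterV rz -[RHS]hsubmxK; congr row_mx.
rewrite [RHS](frame_expand (fiber z) (eo Oz)); apply: eq_bigr => i _.
congr (_ *: _); rewrite -/(frame_coord i z); have [j ->|->] := unliftP ord0 i.
  by rewrite ster_coef_lift lz dE; field.
by rewrite ster_coef0 dE; field.
Qed.

Let oB : open (base @^-1` O : set TE). Proof. exact: open_base. Qed.

Lemma smooth_frame_coord i : smooth_on (base @^-1` O) (frame_coord i).
Proof.
have sb := smooth_base oB.
apply: smooth_dot => //; last exact: (smooth_comp oB oO sb _ (se i)).
  exact: (smooth_comp oB oO sb _ (smooth_sub OU smG)).
exact: smooth_fiber.
Qed.

(** An open set of tangent vectors of any length, on which [ster] is smooth. It provides the local
    smooth extension that [submanifold_chart] requires. *)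
Definition ster_dom : set TE :=
  base @^-1` O `&` (fun z => 1 + frame_coord ord0 z) @^-1` [set r | r != 0].

Lemma open_ster_dom : open ster_dom.
Proof.
have s0 : smooth_on (base @^-1` O) (fun z => 1 + frame_coord ord0 z).
  by apply: smoothD => //; [exact: smooth_cst|exact: smooth_frame_coord].
apply: (continuous_inP _ oB).1; last exact: open_neq.
move=> z /set_mem Oz; apply: differentiable_continuous;
  exact: smooth_diff s0 _ Oz.
Qed.

Lemma smooth_ster : smooth_on ster_dom ster.
Proof.
have od := open_ster_dom.
have sc i : smooth_on ster_dom (frame_coord i).
  by apply: smooth_sub (smooth_frame_coord i) => z [].
apply: smooth_row_mx => //; last exact: smooth_base.
apply/(smooth_mxP od) => i j; under eq_fun do rewrite mxE.
apply: smoothM => //; apply: smoothV => // [z []//|].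
by apply: smoothD => //; exact: smooth_cst.
Qed.

Lemma open_ster_img : open (rsubmx @^-1` O : set Y).
Proof. by apply: open_comp => // y _; exact: continuous_rsubmx. Qed.

Lemma smooth_sterV : smooth_on (rsubmx @^-1` O) sterV.
Proof.
have oI := open_ster_img.
have sr : smooth_on (rsubmx @^-1` O : set Y) rsubmx.
  by apply: (smooth_rsubmx oI); exact: smooth_id.
have /(smooth_mxP oI) sl : smooth_on (rsubmx @^-1` O : set Y) lsubmx.
  by apply: (smooth_lsubmx oI); exact: smooth_id.
have sd : smooth_on (rsubmx @^-1` O) (fun y => (ster_den y)^-1).
  apply: smoothV => // [y _|]; first by rewrite gt_eqF // ster_den_gt0.
  apply: smoothD => //; first exact: smooth_cst.
  by apply: smooth_sum => // j; apply: smoothM.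
apply: smooth_row_mx => //; apply: smooth_sum => // i;
  apply: smooth_scale => //.
  rewrite /ster_coef; case: (unlift ord0 i) => [j|].
    by apply: smoothM => //; apply: smoothM => //; exact: smooth_cst.
  apply: smoothD => //; last exact: smooth_cst.
  by apply: smoothM => //; exact: smooth_cst.
exact: (smooth_comp oI oO sr _ (se i)).
Qed.

End Stereographic.

Section UnitBundleChart.
Context {R : realType} {m : nat} {M : manifold R m.+1}.
Variables (g : riemannian M) (c : chart R M m.+1).
Variables (O : set 'rV[R]_m.+1) (e : 'I_m.+1 -> 'rV[R]_m.+1 -> 'rV[R]_m.+1).
Hypotheses (ac : atlas c) (oe : orthonormal_frame (mcomp c g) (cimg c) O e).
Local Notation G := (mcomp c g).

Let oO : open O. Proof. by case: oe. Qed.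
Let OU : O `<=` cimg c. Proof. by case: oe. Qed.
Let smG : smooth_on (cimg c) G. Proof. exact: metric_smooth. Qed.

Definition ster_cdom : set (TM M) :=
  [set u | [/\ UM g u, cdom c u.1 & ster_dom G O e (tfun c u)]].

Lemma ster_chartK u : ster_cdom u ->
  (tinv c \o sterV e) ((ster G e \o tfun c) u) = u.
Proof.
move=> [u1 cu [Ou pu]] /=; rewrite (sterK oe) //; last exact: UM_fiber.
exact: tchartK.
Qed.

Lemma ster_chart_img :
  (ster G e \o tfun c) @` ster_cdom = rsubmx @^-1` O.
Proof.
apply/seteqP; split=> [_ [u [u1 cu [Ou pu]] <-]|y Oy].
  by rewrite /preimage /= /ster row_mxKr.
have Uy : cimg c (base (sterV e y)) by rewrite base_sterV; exact: OU.
have tK : tfun c (tinv c (sterV e y)) = sterV e y by exact: tinvK.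
exists (tinv c (sterV e y)); last by rewrite /= tK (sterVK oe).
split.
- rewrite /UM /= -(sterV_unit oe Oy) dot_mcomp //.
- by rewrite /tinv /=; have [] := cinvK Uy.
- rewrite tK; split; first by rewrite /preimage /= base_sterV.
  rewrite /preimage /= (ster_pole oe Oy).
  by rewrite mulf_neq0 ?pnatr_eq0 // invr_neq0 // gt_eqF // ster_den_gt0.
Qed.

Lemma open_ster_chart_img : open ((ster G e \o tfun c) @` ster_cdom).
Proof. by rewrite ster_chart_img; exact: open_ster_img oe. Qed.

(** [(m.+1 + m.+1).-1] computes to [m + m.+1], so this has the type expected by [UM_chart]; hence
    the [m] fibre coordinates come before the base point in [ster]. *)
Definition ster_chart : chart R (TM M) (m + m.+1) :=
  Chart ster_chartK open_ster_chart_img.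

Lemma cimg_ster_chart : cimg ster_chart = rsubmx @^-1` O.
Proof. exact: ster_chart_img. Qed.

(** In another chart [d] of the manifold, the inverse chart reads [trans c d] after [sterV], and the
    extension of the chart is [ster] after [trans d c]. *)
Lemma UM_ster_chart : UM_chart g (ster_chart : chart R (TM M) (m.+1 + m.+1).-1).
Proof.
split; first by move=> u [].
- move=> _ [d [ad ->]].
  have oS := open_overlap ac ad.
  have -> : cimg ster_chart `&` cinv ster_chart @^-1` cdom (tchart ad) =
      rsubmx @^-1` (O `&` overlap c d).
    rewrite cimg_ster_chart; apply/seteqP; split=> y.
      rewrite /preimage /= /tdom /tinv /= base_sterV => -[Oy dy].
      by split=> //; split=> //; exact: OU.
    move=> [Oy [_ dy]]; split=> //.
    by rewrite /preimage /= /tdom /tinv /= base_sterV.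
  have oI : open (rsubmx @^-1` (O `&` overlap c d) : set 'rV[R]_(m + m.+1)).
    apply: open_comp => [y _|]; first exact: continuous_rsubmx.
    exact: openI.
  split=> //.
  apply: (@eq_smooth _ _ _ oI _ (trans c d \o sterV e)) => [y [Oy Sy]|].
    have By : cimg c (base (sterV e y)) by rewrite base_sterV; exact: OU.
    rewrite /= -{1}(tinvK ac By) -tfun_trans //=.
      by have [] := cinvK By.
    by case: Sy => _; rewrite /preimage /= base_sterV.
  apply: (smooth_comp oI (open_base oS) _ _ (smooth_trans ac ad)).
    by apply: smooth_sub (smooth_sterV oe) => y [].
  by move=> y [_ Sy]; rewrite /preimage /= base_sterV.
- move=> _ u [d [ad ->]] du [u1 cu tu].
  have oS := open_overlap ad ac.
  have oB := open_base oS.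
  have sT := smooth_trans ad ac.
  have od := open_ster_dom smG oe.
  have tE v : cdom d v.1 -> cdom c v.1 -> trans d c (tfun d v) = tfun c v.
    by move=> dv cv; rewrite -tfun_trans.
  pose Q := base @^-1` overlap d c `&` trans d c @^-1` ster_dom G O e.
  have oQ : open Q.
    apply: (continuous_inP (trans d c) oB).1 => // z /set_mem Bz.
    by apply: differentiable_continuous; exact: smooth_diff sT _ Bz.
  have TQ : smooth_on Q (ster G e \o trans d c).
    apply: (smooth_comp oQ od _ _ (smooth_ster smG oe)).
      by apply: smooth_sub sT => z [].
    by move=> z [].
  have Qu : Q (tfun d u).
    split; last by rewrite -[_ (tfun d u)]/(ster_dom G O e (trans d c _)) tE.
    by rewrite /preimage /= /tfun /base row_mxKl; exact: overlapP.
  have QE v : UM g v -> cdom d v.1 -> Q (tfun d v) ->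
      ster_cdom v /\ (ster G e \o tfun c) v = (ster G e \o trans d c)
        (tfun d v).
    move=> v1 dv [Bv tv].
    have cv : cdom c v.1.
      move: Bv; rewrite /preimage /= /tfun /base row_mxKl => -[_].
      by rewrite /preimage /= chartK.
    rewrite -[_ (tfun d v)]/(ster_dom G O e (trans d c (tfun d v)))
      (tE v dv cv) in tv.
    by split; [split|rewrite [RHS]/= (tE v dv cv)].
  by exists Q, (ster G e \o trans d c); split;
    [exact: oQ|exact: Qu|exact: TQ|exact: QE].
Qed.

End UnitBundleChart.

(** A stereographic chart misses only the unit vectors with coordinate -1 along the first frame
    vector. For these the opposite frame gives the coordinate 1, far from its pole. *)
Lemma UM_chart_exists (R : realType) (n : nat) (M : manifold R n)
    (g : riemannian M) c O e (u : TM M) : atlas c ->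
  orthonormal_frame (mcomp c g) (cimg c) O e -> UM g u -> cdom c u.1 ->
  O (c u.1) -> exists psi, UM_chart g psi /\ cdom psi u.
Proof.
case: n M g c O e u => [|m] M g c O e u ac oe u1 cu Ou.
  (* In dimension 0 the squared length is an empty sum, so there is no unit vector. *)
  by move: u1; rewrite /UM /= dotE big_ord0 => /eqP; rewrite eq_sym oner_eq0.
have psi e' (oe' : orthonormal_frame (mcomp c g) (cimg c) O e') :
    1 + frame_coord (mcomp c g) e' ord0 (tfun c u) != 0 ->
    exists psi, UM_chart g psi /\ cdom psi u.
  move=> p0; exists (ster_chart ac oe'); split; first exact: UM_ster_chart.
  split=> //; split=> //.
  by rewrite /preimage /= /tfun /base row_mxKl.
have [p0|p0] := eqVneq (1 + frame_coord (mcomp c g) e ord0 (tfun c u)) 0;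
  last first.
  exact: psi oe p0.
apply: (psi _ (orthonormal_frameN oe)).
have -> : frame_coord (mcomp c g) (fun i x => - e i x) ord0 (tfun c u) = 1.
  rewrite /frame_coord dotNr; apply/eqP; rewrite -subr_eq0 -opprD oppr_eq0.
  by rewrite addrC; apply/eqP.
by rewrite -mulr2n pnatr_eq0.
Qed.

(** * From the equivalence at a point to the whole manifold *)

Theorem theorem4p1 (R : realType) (n : nat) (M : manifold R n)
    (g : riemannian M) (q : R) (X : M -> 'rV[R]_n)
    (smooth_X : smooth_field X) (unit_X : unit_field g X) :
  magnetic_map g q X <->
  (forall (c : chart R M n) (O : set 'rV[R]_n) (e : 'I_n -> 'rV[R]_n -> 'rV[R]_n),
     atlas c -> orthonormal_frame (mcomp c g) (cimg c) O e ->
     forall x, O x ->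
       tr_curv (mcomp c g) e (vcomp c X) x =
       q *: cov (mcomp c g) (vcomp c X) (vcomp c X) x) /\
  (forall (c : chart R M n) (O : set 'rV[R]_n) (e : 'I_n -> 'rV[R]_n -> 'rV[R]_n),
     atlas c -> orthonormal_frame (mcomp c g) (cimg c) O e ->
     forall x, O x ->
       rough_laplacian (mcomp c g) e (vcomp c X) x =
       normsq_cov (mcomp c g) e (vcomp c X) x *: vcomp c X x).
Proof.
split=> [mX|[trX lapX] c psi p ac upsi cp pp].
  have key (c : chart R M n) O e x : atlas c ->
      orthonormal_frame (mcomp c g) (cimg c) O e -> O x ->
      tr_curv (mcomp c g) e (vcomp c X) x =
        q *: cov (mcomp c g) (vcomp c X) (vcomp c X) x /\
      rough_laplacian (mcomp c g) e (vcomp c X) x =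
        normsq_cov (mcomp c g) e (vcomp c X) x *: vcomp c X x.
    move=> ac oe Ox; have [_ OU _ _] := oe.
    have [p cp cE] := OU _ Ox; rewrite -cE in Ox *.
    (* The frame is given, and a chart of the unit bundle around [X p] has to be found for [mX]. *)
    have [psi [upsi pp]] :=
      @UM_chart_exists _ _ M g c O e (lift_field X p) ac oe (unit_X p) cp Ox.
    apply/(magnetic_at_point smooth_X unit_X ac upsi q cp pp oe Ox).
    exact: mX.
  by split=> c O e ac oe x Ox; have [] := key c O e x ac oe Ox.
have posG y v : cimg c y -> v != 0 -> 0 < dot (mcomp c g y) v v.
  by move=> cy; exact: mcomp_pos.
have oU : open (cimg c) by exact: open_cimg.
(* Here the chart of the unit bundle is given, and a frame on the whole image of [c] is supplied to
   use the two equations at [c p]. *)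
have [e oe] := orthonormal_frame_exists oU (mcomp_sym g c)
  (metric_smooth g ac) posG.
have cpU : cimg c (c p) by exists p.
apply/(magnetic_at_point smooth_X unit_X ac upsi q cp pp oe cpU).
by split; [exact: trX oe _ cpU|exact: lapX oe _ cpU].
Qed.
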